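(* There is a unique $C_0>1$ such that $\frac{C_0}{2}-1-\log C_0=0$, and $C_0<8$. Moreover, fix $C>C_0$, let $\delta=\delta(C)=C-1-\log C>0$, fix $M>\frac1\delta$, and let $\alpha>0$ be such that $\delta(C)-C\left(\alpha+\frac12\right)>0$. Fix $0<\gamma<1$. Then there is a positive constant $L_4$ such that, for all $n\ge L_4$, \[ \mathbb{P}(H_3)\ge 1-e^{-\alpha C}-\gamma, \] where $H_3$ is the event that there exists a vertex $i\in\{1,\dots,n\}$ with $(1-q(C)-\gamma)n\le\#\mathcal{E}_i\le(1-q(C)+\gamma)n$ such that $\#\mathcal{E}_j\le M\log n$ for every vertex $j$ with $\mathcal{E}_j\neq\mathcal{E}_i$.
   Context: Let $C>0$ be a constant and $(\alpha_n)_{n\ge1}$ a sequence of nonnegative reals with $\alpha_n\to0$. For each $n$, consider the complete graph $K_n$ on vertex set $\{1,\dots,n\}$; each edge $e$ of $K_n$ is independently open with probability $p_n(e)$ and closed otherwise, where $\frac{C-\alpha_n}{n}\le p_n(e)\le\frac{C+\alpha_n}{n}$ for every edge $e$. Let $G$ be the resulting random graph of open edges, with probability measure $\mathbb{P}$. For a vertex $i$, $\mathcal{E}_i$ denotes the open component of $G$ containing $i$ (the set of vertices joined to $i$ by a path of open edges, together with $i$ itself), and $\#\mathcal{E}_i$ its number of vertices. $\log$ is the natural logarithm. $T_1=1$ and for $r\ge2$, $T_r$ is the number of labelled trees on $r$ vertices; $q(C)=\sum_{r=1}^\infty \frac{T_rC^{r-1}e^{-Cr}}{(r-1)!}$. 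*)

(* Defs.v *)
From HB Require Import structures.
From mathcomp Require Import all_boot all_order all_algebra.
From mathcomp Require Import all_classical all_reals all_analysis.
Set Implicit Arguments. Unset Strict Implicit. Unset Printing Implicit Defensive.
Import Order.TTheory GRing.Theory Num.Theory numFieldNormedType.Exports.
Local Open Scope ring_scope.

(* Edges of the complete graph K_n on 'I_n: unordered pairs {x,y}, coded as (x,y) with x<y. *)
Definition edge (n : nat) := {p : 'I_n * 'I_n | (p.1 < p.2)%N}.

Definition config (n : nat) := {ffun edge n -> bool}.

Definition adj (n : nat) (w : config n) : rel 'I_n :=
  fun x y => [exists e : edge n, w e && ((val e == (x, y)) || (val e == (y, x)))].

Definition comp (n : nat) (w : config n) (i : 'I_n) : {set 'I_n} :=
  [set j | connect (adj w) i j].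

Definition Prob (R : realType) (n : nat) (p : edge n -> R) (E : pred (config n)) : R :=
  \sum_(w : config n | E w) \prod_(e : edge n) (if w e then p e else 1 - p e).

Definition connectedF (r : nat) (F : {set edge r}) : bool :=
  [forall x : 'I_r, forall y : 'I_r,
     connect (fun a b => [exists e in F, (val e == (a, b)) || (val e == (b, a))]) x y].

(* Labelled trees on r vertices: connected graphs on 'I_r with r-1 edges. *)
Definition Tcount (r : nat) : nat :=
  #|[set F : {set edge r} | connectedF F && (#|F| == r.-1)]|.

(* q(C) = sum_{r>=1} T_r C^{r-1} e^{-Cr} / (r-1)!  (index k = r-1). *)
Definition q (R : realType) (C : R) : R :=
  limn (series (fun k : nat =>
    (Tcount k.+1)%:R * C ^+ k * expR (- (C * k.+1%:R)) / (k`!)%:R)).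

Definition delta (R : realType) (C : R) : R := C - 1 - ln C.

Definition H3 (R : realType) (n : nat) (C M gamma : R) : pred (config n) :=
  fun w => [exists i : 'I_n,
    ((1 - q C - gamma) * n%:R <= #|comp w i|%:R <= (1 - q C + gamma) * n%:R)
    && [forall j : 'I_n, (comp w j != comp w i) ==>
          (#|comp w j|%:R <= M * ln (n%:R : R))]].
Arguments H3 {R} n C M gamma.

(* Main.v *)
(** Components are counted by size, with no exploration process.  A vertex set [S] is a
    component iff it is internally connected and its boundary edges are closed, two
    independent events.  Recording for each vertex its predecessor on a shortest path to
    a root shows that a connected graph on [k + 1] vertices contains [k] distinct edges
    described by one of [(k + 1) ^ k] parent maps; hence the expected number of vertices
    in components of size [s <= n / 2] is at most [n exp (- s (C / 2 - 1 - ln C - o(1)))],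
    and [n exp (- s (delta C - o(1)))] when [s = o(n)].  So, for [C > C0], with high
    probability no component has size between [M ln n] and [n / 2], while few vertices lie
    in components of size between a large constant [K] and [n / 2].  The number of vertices
    in components of size at most [K] has mean asymptotic to [n] times a partial sum of the
    series [q C] (only spanning trees contribute to leading order) and variance [o(n ^ 2)],
    disjoint components being nearly independent.  The complement, of size about
    [(1 - q C) n], is a single component since two components cannot both exceed [n / 2].
    Thus [P(H3) -> 1]. *)
Require Import Defs.
From HB Require Import structures.
From mathcomp Require Import all_boot all_order all_algebra.
From mathcomp Require Import all_classical all_reals all_analysis.
From mathcomp Require Import ring lra zify.
Set Implicit Arguments. Unset Strict Implicit. Unset Printing Implicit Defensive.
Import Order.TTheory GRing.Theory Num.Theory numFieldNormedType.Exports.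
Local Open Scope ring_scope.

(** * Product Bernoulli measures *)

Section BernoulliProduct.
Context {R : realType} {T : finType}.
Implicit Types (p : T -> R) (w : {ffun T -> bool}) (f g : {ffun T -> bool} -> R)
  (D : {set T}).

Definition bern_wt p w : R := \prod_e (if w e then p e else 1 - p e).

Definition bern_exp p f : R := \sum_w bern_wt p w * f w.

Lemma bern_exp_pred p (E : pred {ffun T -> bool}) :
  bern_exp p (fun w => (E w)%:R) = \sum_(w | E w) bern_wt p w.
Proof.
by rewrite [RHS]big_mkcond; apply: eq_bigr => w _; case: (E w); rewrite ?mulr1 ?mulr0.
Qed.

Lemma eq_bern_exp p f g : f =1 g -> bern_exp p f = bern_exp p g.
Proof. by move=> fg; apply: eq_bigr => w _; rewrite fg. Qed.

(** The indicator is a product over coordinates, so the sum over configurations distributes into a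
    product of two-term sums; a coordinate outside [D] contributes [p e + (1 - p e) = 1]. *)
Lemma bern_exp_cylinder p D (b : T -> bool) :
  bern_exp p (fun w => [forall e in D, w e == b e]%:R) =
  \prod_(e in D) (if b e then p e else 1 - p e).
Proof.
transitivity (\prod_e \sum_(c : bool)
    (if e \in D then (c == b e)%:R else 1) * (if c then p e else 1 - p e)).
  rewrite bigA_distr_bigA /=; apply: eq_bigr => w _.
  rewrite mulrC big_split /=; congr (_ * _).
  rewrite -big_mkcond /=; case: forallP => [H|/forallP].
    by rewrite big1// => e eD; move: (H e); rewrite eD /= => /eqP ->; rewrite eqxx.
  rewrite negb_forall => /existsP[e]; rewrite negb_imply => /andP[eD /negbTE h].
  by rewrite (bigD1 e)//= h mul0r.
rewrite [RHS]big_mkcond; apply: eq_bigr => e _.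
rewrite big_bool; case: (e \in D); case: (b e) => /=; ring.
Qed.

Lemma bern_exp_cst p c : bern_exp p (fun=> c) = c.
Proof.
rewrite /bern_exp -mulr_suml -[RHS]mul1r; congr (_ * _).
(* Total mass 1 is the cylinder formula with no constrained coordinate. *)
have := bern_exp_cylinder p finset.set0 xpredT; rewrite big_set0 => <-.
apply: eq_bigr => w _; rewrite (_ : [forall e in _, _]) ?mulr1//.
by apply/forall_inP => e; rewrite inE.
Qed.

Lemma bern_expD p f g :
  bern_exp p (fun w => f w + g w) = bern_exp p f + bern_exp p g.
Proof. by rewrite -big_split; apply: eq_bigr => w _; rewrite mulrDr. Qed.

Lemma bern_expZ p c f : bern_exp p (fun w => c * f w) = c * bern_exp p f.
Proof. by rewrite mulr_sumr; apply: eq_bigr => w _; rewrite mulrCA. Qed.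

Lemma bern_exp_sum p (I : finType) (P : pred I) (F : I -> {ffun T -> bool} -> R) :
  bern_exp p (fun w => \sum_(i | P i) F i w) = \sum_(i | P i) bern_exp p (F i).
Proof. by rewrite exchange_big; apply: eq_bigr => w _; rewrite mulr_sumr. Qed.

Lemma bern_wt_ge0 p w : (forall e, 0 <= p e <= 1) -> 0 <= bern_wt p w.
Proof.
move=> p01; apply: prodr_ge0 => e _; have /andP[? ?] := p01 e.
by case: ifP; rewrite ?subr_ge0.
Qed.

Lemma ler_bern_exp p f g : (forall e, 0 <= p e <= 1) -> (forall w, f w <= g w) ->
  bern_exp p f <= bern_exp p g.
Proof. by move=> p01 fg; apply: ler_sum => w _; rewrite ler_wpM2l ?bern_wt_ge0. Qed.

Lemma bern_exp_ge0 p f : (forall e, 0 <= p e <= 1) -> (forall w, 0 <= f w) ->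
  0 <= bern_exp p f.
Proof. by move=> p01 f0; apply: sumr_ge0 => w _; rewrite mulr_ge0 ?bern_wt_ge0. Qed.

Definition depends_on D (X : Type) (f : {ffun T -> bool} -> X) :=
  forall w w', {in D, w =1 w'} -> f w = f w'.

Definition splice D w w' : {ffun T -> bool} :=
  [ffun e => if e \in D then w e else w' e].

(* [(w, w') |-> (splice w w', splice w' w)] is a weight-preserving involution
   on pairs of independent configurations. *)
Lemma bern_exp_indep p D f g : depends_on D f -> depends_on (~: D) g ->
  bern_exp p (fun w => f w * g w) = bern_exp p f * bern_exp p g.
Proof.
move=> fD gD.
pose W (u : {ffun T -> bool} * {ffun T -> bool}) := bern_wt p u.1 * bern_wt p u.2.
pose s (u : {ffun T -> bool} * {ffun T -> bool}) := (splice D u.1 u.2, splice D u.2 u.1).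
have sK : involutive s.
  by case=> w w'; congr pair; apply/ffunP => e; rewrite !ffunE; case: ifP => /= eD;
    rewrite ?ffunE ?eD.
have Ws u : W (s u) = W u.
  rewrite /W /bern_wt /= -!big_split /=; apply: eq_bigr => e _; rewrite !ffunE.
  by case: (e \in D) => //; rewrite mulrC.
(* Averaging over a second independent copy of mass 1 changes nothing; the involution then moves [g]
   onto that copy. *)
transitivity (\sum_u W u * (f u.1 * g u.1)).
  rewrite -(bern_exp_cst p (bern_exp _ _)) /bern_exp.
  under eq_bigr do rewrite mulr_sumr.
  rewrite exchange_big pair_bigA /=; apply: eq_bigr => u _.
  by rewrite /W; ring.
rewrite (reindex_inj (inv_inj sK)) /bern_exp big_distrlr pair_bigA /=.
apply: eq_bigr => u _; rewrite Ws /W.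
rewrite (fD _ u.1) ?(gD _ u.2); first by ring.
- by move=> e; rewrite inE ffunE => /negbTE ->.
- by move=> e eD; rewrite ffunE eD.
Qed.

End BernoulliProduct.

(** Each point mass pulls back to a cylinder over the image of [h]. This lets the edges inside a
    vertex set be treated as the edges of a smaller complete graph. *)
Lemma bern_exp_pullback {R : realType} {T T' : finType} (p : T -> R) (h : T' -> T)
    (f : {ffun T' -> bool} -> R) : injective h ->
  bern_exp p (fun w => f [ffun e => w (h e)]) = bern_exp (p \o h) f.
Proof.
move=> hI.
transitivity (bern_exp p (fun w =>
    \sum_w' f w' * ([ffun e => w (h e)] == w')%:R)).
  apply: eq_bern_exp => w; rewrite (bigD1 [ffun e => w (h e)])//= eqxx mulr1.
  by rewrite big1 ?addr0// => w' /negbTE ww'; rewrite eq_sym ww' mulr0.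
rewrite bern_exp_sum; apply: eq_bigr => w' _.
rewrite bern_expZ mulrC; congr (_ * _).
pose b e := [exists e', (h e' == e) && w' e'].
have bh e' : b (h e') = w' e'.
  apply/existsP/idP => [[e /andP[/eqP/hI ->]]//|we]; by exists e'; rewrite eqxx.
transitivity (bern_exp p (fun w => [forall e in h @: [set: T'], w e == b e]%:R)).
  apply: eq_bern_exp => w; congr (_%:R); congr nat_of_bool.
  apply/eqP/forall_inP => [ww e /imsetP[e' _ ->]|H].
    by rewrite bh -ww ffunE.
  by apply/ffunP => e'; rewrite ffunE -bh; apply/eqP/H/imset_f.
rewrite bern_exp_cylinder big_imset /=; last by move=> ? ? _ _; exact: hI.
by rewrite /bern_wt; under eq_bigl do rewrite inE; apply: eq_bigr => e _; rewrite bh.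
Qed.

(** * Edges and components *)

Section Edges.
Context {n : nat}.
Implicit Types (e : edge n) (x y : 'I_n) (S : {set 'I_n}) (w : config n).

Definition links e x y : bool := (val e == (x, y)) || (val e == (y, x)).

Lemma links_sym e x y : links e x y = links e y x.
Proof. by rewrite /links orbC. Qed.

Lemma linksP e x y : reflect (val e = (x, y) \/ val e = (y, x)) (links e x y).
Proof. by apply: (iffP orP) => -[/eqP|/eqP]; [left|right|left|right]. Qed.

Lemma links_inj e e' x y : links e x y -> links e' x y -> e = e'.
Proof.
move=> /linksP h /linksP h'; apply: val_inj; have := valP e; have := valP e'.
by case: h' => ->; case: h => -> //=; lia.
Qed.

Lemma links_eq e x y x' y' : links e x y -> links e x' y' ->
  (x' = x /\ y' = y) \/ (x' = y /\ y' = x).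
Proof. by case/linksP => exy /linksP; rewrite exy => -[[-> ->]|[-> ->]]; auto. Qed.

Lemma links_self e : links e (val e).1 (val e).2.
Proof. by rewrite /links -surjective_pairing eqxx. Qed.

(** Lists first an endpoint in [S] if there is one, so that a boundary edge becomes a pair (inside,
    outside) and can be counted in a cartesian product. *)
Definition orient S e : 'I_n * 'I_n :=
  if (val e).1 \in S then val e else ((val e).2, (val e).1).

Lemma links_orient S e : links e (orient S e).1 (orient S e).2.
Proof. by rewrite /orient; case: ifP => _; rewrite ?links_self// links_sym links_self. Qed.

Lemma orient_inj S : injective (orient S).
Proof.
by move=> e e' ee'; apply: (links_inj (links_orient S e)); rewrite ee' links_orient.
Qed.

Lemma exists_edge x y : x != y -> exists e, links e x y.
Proof.
rewrite -val_eqE neq_ltn => /orP[xy|yx].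
  by exists (exist _ (x, y) xy); rewrite /links eqxx.
by exists (exist _ (y, x) yx); rewrite /links eqxx orbT.
Qed.

Definition inner S : {set edge n} :=
  [set e | ((val e).1 \in S) && ((val e).2 \in S)].

Definition boundary S : {set edge n} :=
  [set e | ((val e).1 \in S) != ((val e).2 \in S)].

(** [orient S] maps the boundary bijectively onto the product of [S] and its complement. *)
Lemma card_boundary S : #|boundary S| = (#|S| * (n - #|S|))%N.
Proof.
have -> : (n - #|S|)%N = #|~: S| by have := cardsC S; rewrite card_ord => Sn; apply/eqP;
  rewrite -(eqn_add2l #|S|) Sn subnKC// -[leqRHS]card_ord max_card.
rewrite -cardsX -(card_imset _ (@orient_inj S)); apply: eq_card => -[x y].
rewrite inE /=; apply/imsetP/andP => [[e]|[xS]].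
  rewrite inE /orient => eS /esym xy; move: eS.
  case: ifP xy => h; first by case: (val e) h => a b /= h [<- <-]; rewrite inE;
    case: (b \in S).
  by case: (val e) h => a b /= h [<- <-]; rewrite inE h; case: (b \in S).
rewrite inE => yS.
have xy : x != y by apply: contraNneq yS => <-.
have [e exy] := exists_edge xy; exists e.
  by case/linksP: exy; rewrite inE => -> /=; rewrite xS (negbTE yS).
by case/linksP: exy; rewrite /orient => -> /=; rewrite ?xS ?(negbTE yS).
Qed.

(** An edge leaving both sets joins one to the other: its endpoint in [S] is outside [S'], so its
    other endpoint lies in [S']. *)
Lemma card_boundaryI S S' : [disjoint S & S'] ->
  (#|boundary S :&: boundary S'| <= #|S| * #|S'|)%N.
Proof.
move=> dSS'; rewrite -cardsX -(card_imset _ (@orient_inj S));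
  apply: fintype.subset_leq_card.
have dis x : x \in S -> x \in S' = false by move=> xS; exact: (disjointFr dSS').
apply/fintype.subsetP => _ /imsetP[e + ->]; rewrite !inE /orient => /andP[].
case: ifP => /= [aS _|aS].
  by rewrite aS (dis _ aS) /=; case: (_ \in S').
case: (boolP (_ \in S)) => // bS _; rewrite (dis _ bS).
by case: (_ \in S').
Qed.

Lemma inner_boundaryF S S' e : [disjoint S & S'] -> e \in inner S ->
  e \notin boundary S' .
Proof.
move=> dSS'; rewrite !inE => /andP[aS bS].
by rewrite !(disjointFr dSS').
Qed.

Lemma inner_innerF S S' e : [disjoint S & S'] -> e \in inner S -> e \notin inner S'.
Proof.
move=> dSS'; rewrite !inE => /andP[aS bS].
by rewrite !(disjointFr dSS').
Qed.

Lemma inner_boundary_selfF S e : e \in inner S -> e \notin boundary S.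
Proof. by rewrite !inE => /andP[-> ->]. Qed.

Lemma adj_sym w x y : adj w x y = adj w y x.
Proof. by rewrite /adj; apply: eq_existsb => e; rewrite orbC. Qed.

(** Paths are kept inside [S] so that [conn] reads only inner edges and is independent of
    [cut_closed]. *)
Definition adj_in w S : rel 'I_n := fun x y => [&& x \in S, y \in S & adj w x y].

Definition conn w S := [forall x in S, forall y in S, connect (adj_in w S) x y].

Definition cut_closed w S := [forall e in boundary S, ~~ w e].

(** A closed boundary stops open paths from leaving [S], and internal connectivity lets them reach
    all of [S]. The right side no longer mentions [x] and splits into events on disjoint edge
    sets. *)
Lemma comp_eq w S x : x \in S -> (Defs.comp w x == S) = conn w S && cut_closed w S.
Proof.
move=> xS; apply/eqP/andP => [cS|[/forall_inP cS /forall_inP iS]].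
  have step y z : y \in S -> adj w y z -> z \in S.
    by rewrite -cS !inE => xy yz; apply: connect_trans xy _; exact: connect1.
  split; last first.
    apply/forall_inP => e; rewrite inE => eS; apply: contraNN eS => we.
    have ae : adj w (val e).1 (val e).2.
      by apply/existsP; exists e; rewrite we; exact: links_self.
    apply/eqP; apply/idP/idP => h; first exact: step ae.
    by apply: step h _; rewrite adj_sym.
  have xto y : y \in S -> connect (adj_in w S) x y.
    rewrite -{1}cS inE => /connectP[p + ->].
    elim: p x xS {cS} => [|z p IH] x xS //= /andP[xz zp].
    have zS := step _ _ xS xz.
    apply: connect_trans (IH _ zS zp).
    by apply: connect1; rewrite /adj_in xS zS.
  have sym : connect_sym (adj_in w S).
    by apply: sym_connect_sym => y z; rewrite /adj_in adj_sym andbCA.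
  apply/forall_inP => y yS; apply/forall_inP => z zS.
  by apply: connect_trans (xto _ zS); rewrite sym xto.
apply/setP => y; rewrite inE; apply/idP/idP.
  move=> /connectP[p + ->]; elim: p x xS => [|z p IH] x xS //= /andP[xz zp].
  apply: IH zp; apply: contraTT xz => zS; apply/negP => /existsP[e /andP[we je]].
  suff /iS/negP : e \in boundary S by apply.
  by rewrite inE; case/linksP: je => -> /=; rewrite xS (negbTE zS).
move=> yS; have /forall_inP/(_ _ yS) := cS _ xS.
by apply: connect_sub => a b /and3P[_ _ ab]; exact: connect1.
Qed.

Lemma conn_depends S : depends_on (inner S) (conn^~ S).
Proof.
move=> w w' ww'; apply: eq_forallb_in => x xS; apply: eq_forallb_in => y yS.
apply: eq_connect => a b; rewrite /adj_in.
case: (boolP (a \in S)) => //= aS; case: (boolP (b \in S)) => //= bS.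
apply: eq_existsb => e; case: (boolP (links e a b)) => je; last by rewrite /links in je;
  rewrite (negbTE je) !andbF.
congr (_ && _); apply: ww'.
by case/linksP: je; rewrite inE => -> /=; rewrite aS bS.
Qed.

End Edges.

(** * Connected graphs and parent maps *)

Definition adjF {r} (F : {set edge r}) : rel 'I_r :=
  fun a b => [exists e in F, links e a b].

Lemma connectedFP {r} (F : {set edge r}) :
  reflect (forall x y, connect (adjF F) x y) (connectedF F).
Proof. by apply: (iffP forallP) => h x; [exact/forallP/h|exact/forallP/h]. Qed.

Lemma connect_pathn (T : finType) (r : rel T) x y : connect r x y ->
  exists m, [exists t : m.-tuple T, path r x t && (y == last x t)].
Proof.
case/connectP => p rp ->; exists (size p); apply/existsP.
by exists (in_tuple p); rewrite rp eqxx.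
Qed.

(** [d] is the graph distance from [x], and [z] is the penultimate vertex of a shortest path to
    [y]. *)
Lemma connect_dist (T : finType) (r : rel T) x : (forall y, connect r x y) ->
  exists d : T -> nat, forall y, y != x -> exists2 z, r z y & (d z < d y)%N.
Proof.
move=> cx; pose H y := connect_pathn (cx y); exists (fun y => ex_minn (H y)) => y yx.
case: ex_minnP => m /existsP[[p /= sp] /andP[rp yp]] _.
case: (lastP p) sp rp yp => [|p' y'] sp rp yp; first by rewrite (eqP yp) eqxx in yx.
move: rp; rewrite rcons_path; rewrite last_rcons in yp.
move: sp; rewrite size_rcons => /eqP sp /andP[rp ry].
exists (last x p'); first by rewrite (eqP yp).
case: ex_minnP => m' _ mm'; rewrite -sp ltnS; apply: mm'.
by apply/existsP; exists (in_tuple p'); rewrite rp eqxx.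
Qed.

(** [f v] is the parent of the non-root vertex [lift ord0 v], the root being [ord0]. Arbitrary maps
    are allowed, even with cycles, so that there are exactly [(k + 1) ^ k] of them. *)
Definition parent_edges k (f : {ffun 'I_k -> 'I_k.+1}) : {set edge k.+1} :=
  [set e | [exists v, links e (lift ord0 v) (f v)]].

(* [f] sends a vertex to its predecessor on a shortest path from [ord0]. *)
Lemma connectedF_parent k (F : {set edge k.+1}) : connectedF F ->
  exists f : {ffun 'I_k -> 'I_k.+1}, parent_edges f \subset F /\ #|parent_edges f| = k.
Proof.
move=> /connectedFP cF.
have [d dP] := connect_dist (cF ord0).
have /boolp.choice[g gP] (v : 'I_k) : exists ue : 'I_k.+1 * edge k.+1,
    [/\ ue.2 \in F, links ue.2 (lift ord0 v) ue.1 & (d ue.1 < d (lift ord0 v))%N].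
  have [|u /exists_inP[e eF je] du] := dP (lift ord0 v).
    by rewrite eq_sym neq_lift.
  by exists (u, e); rewrite links_sym.
exists [ffun v => (g v).1].
have -> : parent_edges [ffun v => (g v).1] = [set (g v).2 | v in 'I_k].
  apply/setP => e; rewrite inE; apply/existsP/imsetP => -[v].
    rewrite ffunE => je; exists v => //; have [_ je' _] := gP v; exact: links_inj je je'.
  by move=> _ ->; exists v; rewrite ffunE; have [] := gP v.
split; first by apply/fintype.subsetP => _ /imsetP[v _ ->]; have [] := gP v.
rewrite card_imset ?card_ord// => u v uv.
have [_ ju du] := gP u; have [_ jv dv] := gP v; rewrite uv in ju.
(* Two distinct vertices sharing a parent edge would be each other's parent, each strictly closer to
   the root than the other. *)
case: (links_eq ju jv) => [[/lift_inj -> //]|[h1 h2]].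
by rewrite -h1 in du; rewrite h2 in dv; have := ltn_trans du dv; rewrite ltnn.
Qed.

Lemma connectedF_card k (F : {set edge k.+1}) : connectedF F -> (k <= #|F|)%N.
Proof. by move=> /connectedF_parent[f [/fintype.subset_leq_card + fk]]; rewrite fk. Qed.

(** Numbering the vertices of [S] identifies its inner edges with those of the complete graph on
    [k + 1] vertices, by a map that does not depend on [w]. *)
Lemma conn_embed n (S : {set 'I_n}) k : #|S| = k.+1 ->
  exists2 eh : edge k.+1 -> edge n, injective eh &
    forall w : config n, conn w S = connectedF [set e | w (eh e)].
Proof.
move=> Sk; pose h (i : 'I_k.+1) := enum_val (cast_ord (esym Sk) i).
have hI : injective h by move=> i j /enum_val_inj/cast_ord_inj.
have hS i : h i \in S by exact: enum_valP.
have hsurj x : x \in S -> exists i, x = h i.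
  move=> xS; exists (cast_ord Sk (enum_rank_in xS x)).
  by rewrite /h cast_ordK enum_rankK_in.
have /boolp.choice[eh ehP] (e : edge k.+1) : exists e' : edge n,
    links e' (h (val e).1) (h (val e).2).
  by apply: exists_edge; rewrite (inj_eq hI) -val_eqE neq_ltn (valP e).
exists eh => [e e' ee'|w].
  have := ehP e'; rewrite -ee' => /(links_eq (ehP e))[[/hI h1 /hI h2]|[/hI h1 /hI h2]].
    by apply: val_inj; rewrite [LHS]surjective_pairing -h1 -h2 -surjective_pairing.
  by have := valP e; have := valP e'; rewrite h1 h2 => l1 /(ltn_trans l1); rewrite ltnn.
have ehJ e a b : links e a b -> links (eh e) (h a) (h b).
  by have je := ehP e => /linksP[] eab; rewrite eab in je; rewrite // links_sym.
have adjE a b : adj_in w S (h a) (h b) = adjF [set e | w (eh e)] a b.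
  rewrite /adj_in !hS /=; apply/existsP/exists_inP => [[e /andP[we je]]|[e]].
    have ab : a != b.
      apply: contraTneq (valP e) => ab; rewrite ab in je.
      by case/linksP: je => -> /=; rewrite ltnn.
    have [e' je'] := exists_edge ab; exists e' => //.
    by rewrite inE -(links_inj je (ehJ _ _ _ je')).
  by rewrite inE => we /ehJ je; exists (eh e); rewrite we.
apply/forall_inP/connectedFP => [cS a b|cF x /hsurj[a ->]].
  have /forall_inP/(_ _ (hS b))/connectP[p] := cS _ (hS a).
  elim: p a => [|y p IH] a /=; first by move=> _ /hI ->.
  move=> /andP[ay yp] lb; have /and3P[_ /hsurj[c yc] _] := ay; subst y.
  by apply: connect_trans (IH _ yp lb); apply: connect1; rewrite -adjE.
apply/forall_inP => _ /hsurj[b ->].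
have /connectP[p] := cF a b.
elim: p a => [|y p IH] a /=; first by move=> _ ->.
move=> /andP[ay yp] lb; apply: connect_trans (IH _ yp lb).
by apply: connect1; rewrite adjE.
Qed.

(** * Probability that a small random graph is connected *)

Section ConnectedProbability.
Context {R : realType} {k : nat}.
Variables (p : edge k.+1 -> R) (x y : R).
Hypotheses (p01 : forall e, 0 <= p e <= 1) (px : forall e, p e <= x) (x0 : 0 <= x).

Let openF (w : config k.+1) : {set edge k.+1} := [set e | w e].

Let cyl (F : {set edge k.+1}) :
  bern_exp p (fun w => (F \subset openF w)%:R) <= x ^+ #|F|.
Proof.
rewrite (@eq_bern_exp _ _ _ _ (fun w : config k.+1 => [forall e in F, w e == true]%:R)).
  rewrite bern_exp_cylinder -prodr_const; apply: ler_prod => e _.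
  by rewrite px andbT; have /andP[] := p01 e.
move=> w; congr (nat_of_bool _)%:R; apply/fintype.subsetP/forall_inP => h e /h.
  by rewrite inE => ->.
by rewrite inE => /eqP.
Qed.

(** Union bound over the parent maps with [k] distinct edges, each wholly open with probability at
    most [x ^ k]. The bound is crude but explicit in [k], as sizes growing with [n] require. *)
Lemma prob_connected_le :
  bern_exp p (fun w => (connectedF (openF w))%:R) <= k.+1%:R ^+ k * x ^+ k.
Proof.
apply: (@le_trans _ _ (\sum_(f : {ffun 'I_k -> 'I_k.+1} | #|parent_edges f| == k) x ^+ k)).
  apply: (@le_trans _ _ (bern_exp p (fun w => \sum_(f : {ffun 'I_k -> 'I_k.+1} |
    #|parent_edges f| == k)
      (parent_edges f \subset openF w)%:R))).
    apply: ler_bern_exp => // w;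
      case: (boolP (connectedF _)) => [/connectedF_parent[f [fw fk]]|_];
      last exact: sumr_ge0.
    by rewrite (bigD1 f) ?fk ?eqxx//= fw lerDl sumr_ge0.
  by rewrite bern_exp_sum; apply: ler_sum => f /eqP fk; rewrite -[in leRHS]fk; exact: cyl.
apply: (@le_trans _ _ (\sum_(f : {ffun 'I_k -> 'I_k.+1}) x ^+ k)).
  by rewrite big_mkcond; apply: ler_sum => f _; case: ifP => // _; exact: exprn_ge0.
by rewrite sumr_const card_ffun !card_ord -natrX mulr_natl.
Qed.

Let wt_setE (F : {set edge k.+1}) : bern_wt p [ffun e => e \in F] =
  (\prod_(e in F) p e) * \prod_(e in ~: F) (1 - p e).
Proof.
rewrite /bern_wt (bigID (mem F)) /=; congr (_ * _).
  by apply: eq_bigr => e eF; rewrite ffunE eF.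
by apply: eq_big => e; [rewrite inE|move=> /negbTE eF; rewrite ffunE eF].
Qed.

Let prob_connectedE : bern_exp p (fun w => (connectedF (openF w))%:R) =
  \sum_(F : {set edge k.+1} | connectedF F) bern_wt p [ffun e => e \in F].
Proof.
rewrite bern_exp_pred (reindex (fun F : {set edge k.+1} => [ffun e => e \in F])) /=.
  apply: eq_bigl => F; congr connectedF; apply/setP => e; by rewrite inE ffunE.
exists openF => [F _|w _]; first by apply/setP => e; rewrite inE ffunE.
by apply/ffunP => e; rewrite ffunE inE.
Qed.

Let TcountE : (Tcount k.+1)%:R =
  \sum_(F : {set edge k.+1} | connectedF F && (#|F| == k)) 1 :> R.
Proof. by rewrite /Tcount cardsE sumr_const. Qed.

(** Connected graphs with [k] edges are the spanning trees; all others have at least [k + 1] edges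
    and cost an extra factor [x], later of order [1 / n]. *)
Lemma prob_connected_upper : x <= 1 ->
  bern_exp p (fun w => (connectedF (openF w))%:R) <=
  (Tcount k.+1)%:R * x ^+ k + #|{set edge k.+1}|%:R * x ^+ k.+1.
Proof.
move=> x1; rewrite prob_connectedE (bigID (fun F : {set edge _} => #|F| == k)) /=.
have wtF (F : {set edge k.+1}) : bern_wt p [ffun e => e \in F] <= x ^+ #|F|.
  rewrite wt_setE -[leRHS]mulr1; apply: ler_pM.
  - by apply: prodr_ge0 => e _; case/andP: (p01 e).
  - by apply: prodr_ge0 => e _; rewrite subr_ge0; case/andP: (p01 e).
  - by rewrite -prodr_const; apply: ler_prod => e _; rewrite px andbT; case/andP: (p01 e).
  - apply: (@le_trans _ _ (\prod_(e in ~: F) 1)); last by rewrite big1.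
    by apply: ler_prod => e _; case/andP: (p01 e) => *; apply/andP; split; lra.
apply: lerD.
  by rewrite TcountE mulr_suml; apply: ler_sum => F /andP[_ /eqP Fk];
    rewrite mul1r -[in leRHS]Fk.
rewrite -sumr_const mulr_suml big_mkcond /=; apply: ler_sum => F _; rewrite mul1r.
case: ifP => [/andP[/connectedF_card Fk Fnk]|_]; last exact: exprn_ge0.
apply: le_trans (wtF F) _; apply: ler_wiXn2l => //.
by rewrite ltn_neqAle eq_sym Fnk.
Qed.

(** Only configurations that are exactly a spanning tree are kept; their closed edges cost at most
    one factor [1 - x] for each edge of the complete graph. *)
Lemma prob_connected_lower : (forall e, y <= p e) -> 0 <= y -> x <= 1 ->
  (Tcount k.+1)%:R * y ^+ k * (1 - x) ^+ #|{: edge k.+1}| <=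
  bern_exp p (fun w => (connectedF (openF w))%:R).
Proof.
move=> yp y0 x1; rewrite prob_connectedE (bigID (fun F : {set edge _} => #|F| == k)) /=.
rewrite -[leLHS]addr0; apply: lerD; last first.
  by apply: sumr_ge0 => F _; exact: bern_wt_ge0.
rewrite TcountE !mulr_suml; apply: ler_sum => F /andP[_ /eqP Fk].
rewrite mul1r wt_setE; apply: ler_pM.
- exact: exprn_ge0.
- by rewrite exprn_ge0// subr_ge0.
- by rewrite -[in leLHS]Fk -prodr_const; apply: ler_prod => e _; rewrite y0 yp.
apply: (@le_trans _ _ ((1 - x) ^+ #|~: F|)).
  by apply: ler_wiXn2l; rewrite ?subr_ge0 ?gerBl ?max_card.
rewrite -prodr_const; apply: ler_prod => e _.
by rewrite subr_ge0 x1 lerD2l lerN2 px.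
Qed.

End ConnectedProbability.

(** * Moments of component counts *)

Definition is_comp {n} (w : config n) (S : {set 'I_n}) := conn w S && cut_closed w S.

Definition num_in {n} (A : pred nat) (w : config n) : nat :=
  #|[set i | A #|Defs.comp w i|]|.

(** Double counting: an admissible component is counted once for each of its vertices. *)
Lemma num_in_comps {n} (A : pred nat) (w : config n) :
  num_in A w = (\sum_(S : {set 'I_n} | A #|S|) #|S| * is_comp w S)%N.
Proof.
rewrite /num_in -sum1_card big_mkcond /=.
transitivity (\sum_(i : 'I_n) \sum_(S : {set 'I_n} | A #|S|) (Defs.comp w i == S))%N.
  apply: eq_bigr => i _; rewrite inE; case: ifPn => Ai.
    rewrite (bigD1 (Defs.comp w i))//= eqxx big1 ?addn0// => S /andP[_ /negbTE iS].
    by rewrite eq_sym iS.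
  by rewrite big1// => S AS; case: eqP => // iS; rewrite iS AS in Ai.
rewrite exchange_big /=; apply: eq_bigr => S AS.
rewrite (bigID (mem S)) /= [X in (_ + X)%N]big1 ?addn0 => [|i iS].
  by under eq_bigr => i iS do rewrite comp_eq//; rewrite sum_nat_const.
by case: eqP iS => // <-; rewrite inE connect0.
Qed.

Lemma num_in_sizes {n} (A : pred nat) (w : config n) :
  num_in A w = (\sum_(k < n | A k.+1) num_in (pred1 k.+1) w)%N.
Proof.
rewrite /num_in -sum1_card big_mkcond /=.
under [RHS]eq_bigr do rewrite -sum1_card big_mkcond /=.
rewrite exchange_big /=; apply: eq_bigr => i _; rewrite inE.
have c0 : (0 < #|Defs.comp w i|)%N by apply/card_gt0P; exists i; rewrite inE connect0.
have cn : (#|Defs.comp w i|.-1 < n)%N.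
  by rewrite prednK// -[leqRHS]card_ord max_card.
under eq_bigr do rewrite inE /=.
case: ifPn => Ai.
  rewrite (bigD1 (Ordinal cn)) /= ?prednK// eqxx big1 ?addn0// => k /andP[_].
  rewrite -val_eqE /= => kc; case: eqP => // ck; by rewrite ck eqxx in kc.
by rewrite big1// => k Ak; case: eqP => // ik; rewrite ik Ak in Ai.
Qed.

Lemma num_in_le {n} (A : pred nat) (w : config n) : (num_in A w <= n)%N.
Proof. by rewrite -[leqRHS]card_ord; exact: max_card. Qed.

Lemma is_comp_disjoint {n} (w : config n) (S S' : {set 'I_n}) :
  is_comp w S -> is_comp w S' -> S != S' -> [disjoint S & S'].
Proof.
move=> cS cS' SS'; apply/pred0P => i /=; apply/negP => /andP[iS iS'].
case/eqP: SS'; move: cS cS'; rewrite /is_comp -(comp_eq w iS) -(comp_eq w iS').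
by move=> /eqP -> /eqP.
Qed.

(** Two components are equal or disjoint; the equal pairs give a sum of squared sizes, at most [K]
    times the number of vertices counted. *)
Lemma num_in_sqr_le {n} (A : pred nat) (K : nat) (w : config n) :
  (forall s, A s -> (s <= K)%N) ->
  (num_in A w ^ 2 <= K * n + \sum_(S : {set 'I_n} | A #|S|)
    \sum_(S' : {set 'I_n} | A #|S'| && [disjoint S & S'])
      #|S| * #|S'| * (is_comp w S && is_comp w S'))%N.
Proof.
move=> AK; apply: (@leq_trans (K * num_in A w + \sum_(S : {set 'I_n} | A #|S|)
    \sum_(S' : {set 'I_n} | A #|S'| && [disjoint S & S'])
      #|S| * #|S'| * (is_comp w S && is_comp w S'))); last first.
  by rewrite leq_add2r leq_mul// num_in_le.
rewrite num_in_comps -mulnn big_distrl big_distrr /= -big_split /=.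
apply: leq_sum => S AS; case: (boolP (is_comp w S)) => cS; last first.
  by rewrite muln0 mul0n.
rewrite muln1 big_distrr /= (bigID (fun S' : {set 'I_n} => [disjoint S & S'])) /= addnC.
apply: leq_add; last by apply: leq_sum => S' _; rewrite mulnA.
apply: (@leq_trans (\sum_(S' | S' == S) #|S| * (#|S'| * is_comp w S')))%N.
  rewrite big_mkcond [leqRHS]big_mkcond; apply: leq_sum => S' _.
  case: ifP => // /andP[_ dSS']; case: eqP => // SS'.
  case: (boolP (is_comp w S')) => cS'; last by rewrite !muln0.
  by case/negP: dSS'; apply: is_comp_disjoint cS cS' _; apply/eqP => h; case: SS'.
by rewrite big_pred1_eq cS muln1 leq_mul// AK.
Qed.

Section ComponentProbability.
Context {R : realType} {n : nat}.
Variables (p : edge n -> R) (x : R).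
Hypotheses (p01 : forall e, 0 <= p e <= 1) (px : forall e, p e <= x) (x1 : x < 1).
Implicit Types (S : {set 'I_n}) (w : config n).

Definition comp_prob S := bern_exp p (fun w => (is_comp w S)%:R).

Lemma comp_prob_ge0 S : 0 <= comp_prob S.
Proof. exact: bern_exp_ge0. Qed.

Lemma prob_closed (D : {set edge n}) :
  bern_exp p (fun w => [forall e in D, ~~ w e]%:R) = \prod_(e in D) (1 - p e).
Proof.
rewrite -(bern_exp_cylinder p D xpred0); apply: eq_bern_exp => w.
by congr (nat_of_bool _)%:R; apply: eq_forallb_in => e _; rewrite eqbF_neg.
Qed.

Lemma closed_depends (D D' : {set edge n}) : {subset D <= D'} ->
  depends_on D' (fun w => [forall e in D, ~~ w e]).
Proof. by move=> DD' w w' ww'; apply: eq_forallb_in => e /DD' eD; rewrite ww'. Qed.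

Lemma comp_probE S : comp_prob S =
  bern_exp p (fun w => (conn w S)%:R) * \prod_(e in boundary S) (1 - p e).
Proof.
rewrite -prob_closed -(@bern_exp_indep _ _ p (inner S)).
- by apply: eq_bern_exp => w; rewrite -natrM mulnb.
- by move=> w w' ww'; rewrite (conn_depends ww').
move=> w w' ww'; congr (nat_of_bool _)%:R.
apply: closed_depends ww' => e; rewrite finset.in_setC; apply: contraL.
exact: inner_boundary_selfF.
Qed.

Lemma prod_setU_setI (D D' : {set edge n}) (F : edge n -> R) :
  \prod_(e in D :|: D') F e * \prod_(e in D :&: D') F e =
  \prod_(e in D) F e * \prod_(e in D') F e.
Proof.
rewrite (big_setID D') /= [in RHS](big_setID D') /= finset.setIUl finset.setIid.
have -> : (D :&: D') :|: D' = D' by apply/finset.setUidPr; exact: finset.subsetIr.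
have -> : (D :|: D') :\: D' = D :\: D'.
  by apply/setP => e; rewrite !inE; case: (e \in D'); case: (e \in D).
by ring.
Qed.

(** Connectivity of [S], connectivity of [S'] and closedness of the union of the boundaries involve
    disjoint edge sets. The common boundary edges enter once in the joint event and twice on the
    right; the extra product compensates without division. *)
Lemma comp_prob_pair S S' : [disjoint S & S'] ->
  bern_exp p (fun w => (is_comp w S && is_comp w S')%:R) *
    \prod_(e in boundary S :&: boundary S') (1 - p e) =
  comp_prob S * comp_prob S'.
Proof.
move=> dSS'; have dS'S : [disjoint S' & S] by rewrite disjoint_sym.
pose B := boundary S :|: boundary S'.
have dB : depends_on (~: inner S') (fun w => [forall e in B, ~~ w e]%:R : R).
  move=> w w' ww'; congr (nat_of_bool _)%:R; apply: closed_depends ww' => e.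
  rewrite finset.in_setC; apply: contraL => eS'; rewrite inE negb_or.
  by rewrite (inner_boundaryF dS'S eS') inner_boundary_selfF.
rewrite !comp_probE.
have -> : bern_exp p (fun w => (is_comp w S && is_comp w S')%:R) =
    bern_exp p (fun w => (conn w S)%:R) * (bern_exp p (fun w => (conn w S')%:R) *
      \prod_(e in B) (1 - p e)).
  rewrite -prob_closed -(@bern_exp_indep _ _ p (inner S')) //; last first.
    by move=> w w' ww'; rewrite (conn_depends ww').
  rewrite -(@bern_exp_indep _ _ p (inner S)) //.
  - apply: eq_bern_exp => w; rewrite -!natrM !mulnb; congr (nat_of_bool _)%:R.
    rewrite /is_comp andbACA -andbA; congr (_ && (_ && _)).
    apply/andP/forall_inP => [[/forall_inP h /forall_inP h'] e|h].
      by rewrite inE => /orP[/h|/h'].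
    by split; apply/forall_inP => e eS; apply: h; rewrite inE eS ?orbT.
  - by move=> w w' ww'; rewrite (conn_depends ww').
  move=> w w' ww'; congr (_ * _).
    rewrite (@conn_depends _ S' w w')// => e eS'; apply: ww'.
    by rewrite inE; exact: inner_innerF eS'.
  congr (nat_of_bool _)%:R; apply: closed_depends ww' => e.
  rewrite finset.in_setC; apply: contraL => eS; rewrite inE negb_or.
  by rewrite (inner_boundaryF dSS' eS) inner_boundary_selfF.
by rewrite -!mulrA prod_setU_setI; ring.
Qed.

Let EN (A : pred nat) := bern_exp p (fun w => (num_in A w)%:R).

Lemma exp_num_in A : EN A = \sum_(S : {set 'I_n} | A #|S|) #|S|%:R * comp_prob S.
Proof.
rewrite /EN (@eq_bern_exp _ _ _ _ (fun w => \sum_(S : {set 'I_n} | A #|S|) #|S|%:R *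
  (is_comp w S)%:R)).
  by rewrite bern_exp_sum; apply: eq_bigr => S _; rewrite bern_expZ.
by move=> w; rewrite num_in_comps natr_sum; apply: eq_bigr => S _; rewrite natrM.
Qed.

Lemma exp_num_in_sizes A : EN A = \sum_(k < n | A k.+1) EN (pred1 k.+1).
Proof.
rewrite -bern_exp_sum; apply: eq_bern_exp => w; by rewrite num_in_sizes natr_sum.
Qed.

(** Equal pairs give [K * n]. Disjoint sets of size at most [K] have at most [K ^ 2] common boundary
    edges, which bounds the ratio of the joint probability to the product. *)
Lemma second_moment (A : pred nat) (K : nat) : 0 <= x -> (forall s, A s -> (s <= K)%N) ->
  bern_exp p (fun w => (num_in A w)%:R ^+ 2) <=
  K%:R * n%:R + EN A ^+ 2 / (1 - x) ^+ (K ^ 2).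
Proof.
move=> x0 AK.
apply: (@le_trans _ _ (bern_exp p (fun w => (K * n)%:R + \sum_(S : {set 'I_n} | A #|S|)
    \sum_(S' : {set 'I_n} | A #|S'| && [disjoint S & S'])
      (#|S| * #|S'|)%:R * (is_comp w S && is_comp w S')%:R))).
  apply: ler_bern_exp => // w; rewrite -natrX.
  under eq_bigr do under eq_bigr do rewrite -natrM.
  under eq_bigr do rewrite -natr_sum.
  by rewrite -natr_sum -natrD ler_nat; exact: num_in_sqr_le.
rewrite bern_expD bern_exp_cst natrM lerD2l bern_exp_sum.
rewrite exp_num_in expr2 mulr_suml mulr_suml; apply: ler_sum => S AS.
rewrite bern_exp_sum mulr_sumr mulr_suml big_mkcondr; apply: ler_sum => S' AS'.
have y0 : 0 < 1 - x by rewrite subr_gt0.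
case: ifP => dSS'; last first.
  rewrite divr_ge0 ?exprn_ge0 ?(ltW y0)//.
  by apply: mulr_ge0; apply: mulr_ge0; rewrite ?comp_prob_ge0.
rewrite bern_expZ ler_pdivlMr ?exprn_gt0// mulrACA -comp_prob_pair// natrM -[leLHS]mulrA.
apply: ler_wpM2l; first by rewrite mulr_ge0.
apply: ler_wpM2l; first exact: bern_exp_ge0.
apply: (@le_trans _ _ ((1 - x) ^+ #|boundary S :&: boundary S'|)).
  apply: ler_wiXn2l; rewrite ?(ltW y0) ?gerBl//.
  by rewrite (leq_trans (card_boundaryI dSS'))// -mulnn leq_mul// AK.
rewrite -prodr_const; apply: ler_prod => e _.
by rewrite (ltW y0) lerD2l lerN2 px.
Qed.

Lemma sum_size_cst k (c : R) :
  \sum_(S : {set 'I_n} | #|S| == k.+1) #|S|%:R * c = n%:R * 'C(n.-1, k)%:R * c.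
Proof.
under eq_bigr => S /eqP Sk do rewrite Sk.
(* The identity [(k + 1) * 'C(n, k + 1) = n * 'C(n - 1, k)] extracts the factor [n]. *)
rewrite sumr_const -[n in RHS](card_ord n) -natrM mul_bin_diag -cardsE card_draws.
by rewrite natrM -[LHS]mulr_natl; ring.
Qed.

Lemma exp_size_le k c : (forall S, #|S| = k.+1 -> comp_prob S <= c) ->
  EN (pred1 k.+1) <= n%:R * 'C(n.-1, k)%:R * c.
Proof.
move=> Sc; rewrite exp_num_in -sum_size_cst; apply: ler_sum => S /eqP Sk.
by rewrite ler_wpM2l// Sc.
Qed.

Lemma exp_size_ge k c : (forall S, #|S| = k.+1 -> c <= comp_prob S) ->
  n%:R * 'C(n.-1, k)%:R * c <= EN (pred1 k.+1).
Proof.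
move=> Sc; rewrite exp_num_in -sum_size_cst; apply: ler_sum => S /eqP Sk.
by rewrite ler_wpM2l// Sc.
Qed.

Variable y : R.
Hypotheses (yp : forall e, y <= p e) (y0 : 0 <= y) (yx : y <= x).

Let x0 : 0 <= x. Proof. exact: le_trans y0 yx. Qed.

Let closed_le S : \prod_(e in boundary S) (1 - p e) <= (1 - y) ^+ (#|S| * (n - #|S|)).
Proof.
rewrite -card_boundary -prodr_const; apply: ler_prod => e _.
by rewrite subr_ge0 lerD2l lerN2 yp; case/andP: (p01 e) => _ ->.
Qed.

Let closed_ge S : (1 - x) ^+ (#|S| * (n - #|S|)) <= \prod_(e in boundary S) (1 - p e).
Proof.
rewrite -card_boundary -prodr_const; apply: ler_prod => e _.
by rewrite subr_ge0 (ltW x1) lerD2l lerN2 px.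
Qed.

Let connE S k : #|S| = k.+1 -> exists2 eh : edge k.+1 -> edge n, injective eh &
  bern_exp p (fun w => (conn w S)%:R) =
  bern_exp (p \o eh) (fun w : config k.+1 => (connectedF [set e | w e])%:R).
Proof.
move=> /conn_embed[eh ehI ehP]; exists eh => //;
rewrite -(@bern_exp_pullback _ _ _ p eh (fun w : config k.+1 => (connectedF [set e | w
  e])%:R))//.
apply: eq_bern_exp => w; rewrite ehP; congr (nat_of_bool (connectedF _))%:R.
by apply/setP => e; rewrite !inE ffunE.
Qed.

Let closed_ge0 S : 0 <= \prod_(e in boundary S) (1 - p e).
Proof. by apply: prodr_ge0 => e _; rewrite subr_ge0; case/andP: (p01 e). Qed.

Let conn_ge0 S : 0 <= bern_exp p (fun w => (conn w S)%:R).
Proof. exact: bern_exp_ge0. Qed.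

(** This form is explicit in [k] and serves sizes growing with [n]; the next two are sharp to
    leading order for fixed [k]. *)
Lemma exp_size_tail k : EN (pred1 k.+1) <=
  n%:R * 'C(n.-1, k)%:R *
    (k.+1%:R ^+ k * x ^+ k * (1 - y) ^+ (k.+1 * (n - k.+1))).
Proof.
apply: exp_size_le => S Sk; rewrite comp_probE -Sk; apply: ler_pM => //.
have [eh ehI ->] := connE Sk; rewrite Sk.
by apply: prob_connected_le => // e; [exact: p01|exact: px].
Qed.

Lemma exp_size_upper k : EN (pred1 k.+1) <=
  n%:R * 'C(n.-1, k)%:R *
    (((Tcount k.+1)%:R * x ^+ k + #|{set edge k.+1}|%:R * x ^+ k.+1) *
     (1 - y) ^+ (k.+1 * (n - k.+1))).
Proof.
apply: exp_size_le => S Sk; rewrite comp_probE; have := closed_le S; rewrite Sk => cl;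
  apply: ler_pM => //.
have [eh ehI ->] := connE Sk.
by apply: prob_connected_upper => // [e|e|]; [exact: p01|exact: px|exact: ltW].
Qed.

Lemma exp_size_lower k : n%:R * 'C(n.-1, k)%:R *
    ((Tcount k.+1)%:R * y ^+ k * (1 - x) ^+ #|{: edge k.+1}| *
     (1 - x) ^+ (k.+1 * (n - k.+1))) <= EN (pred1 k.+1).
Proof.
have x1' : 0 <= 1 - x by rewrite subr_ge0 ltW.
apply: exp_size_ge => S Sk; rewrite comp_probE; have := closed_ge S; rewrite Sk => cl;
  apply: ler_pM => //.
- by rewrite !mulr_ge0 ?exprn_ge0.
- by rewrite exprn_ge0.
have [eh ehI ->] := connE Sk.
by apply: prob_connected_lower => // [e|e|e|]; [exact: p01|exact: px|exact: yp|exact: ltW].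
Qed.

End ComponentProbability.

(** * Chebyshev and Markov inequalities *)

Lemma bern_chebyshev {R : realType} {T : finType} (p : T -> R)
    (f : {ffun T -> bool} -> R) (t : R) : (forall e, 0 <= p e <= 1) -> 0 <= t ->
  bern_exp p (fun w => (t <= `|f w - bern_exp p f|)%R%:R) * t ^+ 2 <=
  bern_exp p (fun w => f w ^+ 2) - bern_exp p f ^+ 2.
Proof.
move=> p01 t0; set m := bern_exp p f.
have -> : bern_exp p (fun w => f w ^+ 2) - m ^+ 2 = bern_exp p (fun w => (f w - m) ^+ 2).
  rewrite (@eq_bern_exp _ _ _ (fun w => (f w - m) ^+ 2) (fun w => f w ^+ 2 + ((- (2 * m))
    * f w + m ^+ 2))).
    by rewrite bern_expD bern_expD bern_expZ bern_exp_cst -/m; ring.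
  by move=> w; ring.
rewrite mulrC -bern_expZ; apply: ler_bern_exp => // w.
case: (leP t `|f w - m|) => h; last by rewrite mulr0 sqr_ge0.
by rewrite mulr1 -[leRHS]real_normK ?num_real// lerXn2r// nnegrE.
Qed.

Lemma bern_markov {R : realType} {T : finType} (p : T -> R)
    (f : {ffun T -> bool} -> R) (t : R) : (forall e, 0 <= p e <= 1) ->
  (forall w, 0 <= f w) -> 0 <= t ->
  bern_exp p (fun w => (t <= f w)%R%:R) * t <= bern_exp p f.
Proof.
move=> p01 f0 t0; rewrite mulrC -bern_expZ; apply: ler_bern_exp => // w.
by case: (leP t (f w)) => h; rewrite ?mulr1 ?mulr0.
Qed.

(** * The threshold C0 *)

Section Root.
Context {R : realType}.
Implicit Types (C : R).

Lemma ln_le_tangent (a b : R) : 0 < a -> 0 < b -> ln b <= ln a + (b - a) / a.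
Proof.
move=> a0 b0; have -> : b = a * (1 + (b - a) / a) by field; rewrite gt_eqF.
have ba0 : 0 < 1 + (b - a) / a.
  have -> : 1 + (b - a) / a = b / a by field; rewrite gt_eqF.
  exact: divr_gt0.
rewrite lnM ?posrE// lerD2l [leRHS](_ : _ = (b - a) / a); last by field; rewrite gt_eqF.
by apply: le_ln1Dx; lra.
Qed.

(** For [1 < a <= 2] the expression is negative. Past 2 its derivative [1 / 2 - 1 / a] is positive,
    so uniqueness will follow from monotonicity there. *)
Lemma root_gt2 (a : R) : 1 < a -> a / 2 - 1 - ln a = 0 -> 2 < a.
Proof.
move=> a1 fa; rewrite ltNge; apply/negP => a2.
by have := ln_gt0 a1; lra.
Qed.

Lemma half_sub_ln_lt (a b : R) : 2 < a -> a < b -> a / 2 - 1 - ln a < b / 2 - 1 - ln b.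
Proof.
move=> a2 ab; have a0 : 0 < a by lra.
have h := ln_le_tangent a0 (lt_trans a0 ab).
have : (b - a) / a < (b - a) / 2.
  by rewrite ltr_pM2l ?subr_gt0// ltf_pV2 ?posrE.
lra.
Qed.

(** [exp 3 = (exp (1 / 2)) ^ 6 >= (3 / 2) ^ 6 = 729 / 64 > 8]. *)
Lemma ln8_lt3 : ln 8 < 3 :> R.
Proof.
rewrite -[ltRHS]expRK ltr_ln ?posrE ?expR_gt0//.
have h : 3 / 2 <= expR (2^-1) :> R by have := expR_ge1Dx (2^-1 : R); lra.
have -> : 3 = 6%:R * 2^-1 :> R by field.
rewrite expRM_natl; apply: (@lt_le_trans _ _ ((3 / 2) ^+ 6)).
  by rewrite !exprS expr0; lra.
by rewrite lerXn2r ?nnegrE ?expR_ge0// divr_ge0.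
Qed.

Lemma root_lt8 (a : R) : 1 < a -> a / 2 - 1 - ln a = 0 -> a < 8.
Proof.
move=> a1 fa; rewrite ltNge le_eqVlt; apply/negP => /orP[/eqP a8|a8].
  by have := ln8_lt3; rewrite a8; lra.
have h8 : 2 < 8 :> R by lra.
by have := half_sub_ln_lt h8 a8; have := ln8_lt3; lra.
Qed.

Lemma root_unique : exists! a : R, 1 < a /\ a / 2 - 1 - ln a = 0.
Proof.
pose f (a : R) := a / 2 - 1 - ln a.
(* The values at the endpoints are [- 1 / 2] and [3 - ln 8 > 0]. *)
have [|||a /itvP a18 fa] := @IVT R f 1 8 0.
- by lra.
- apply/continuous_in_subspaceT => x; rewrite inE /= in_itv /= => /andP[x1 _].
  apply: cvgB; last by apply: continuous_ln; lra.
  by apply: cvgB; [apply: cvgMl; exact: cvg_id|exact: cvg_cst].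
- have := ln8_lt3; rewrite /f ln1 subr0 => h.
  by rewrite ge_min le_max; apply/andP; split; apply/orP; [left|right]; lra.
have a1 : 1 <= a by rewrite a18.
rewrite /f in fa.
have {}a1 : 1 < a.
  by rewrite lt_neqAle a1 andbT; apply/eqP => a1'; move: fa; rewrite -a1' ln1; lra.
exists a; split=> // b [b1 fb].
have a2 := root_gt2 a1 fa; have b2 := root_gt2 b1 fb.
case: (ltgtP a b) => // ab; first by have := half_sub_ln_lt a2 ab; rewrite fa fb ltxx.
by have := half_sub_ln_lt b2 ab; rewrite fa fb ltxx.
Qed.
End Root.

(** * Limits and tail estimates *)

Local Open Scope classical_set_scope.

Section Limits.
Context {R : realType}.
Implicit Types (u v : nat -> R) (C l : R).

Lemma cvgn_near_eq u v l : u @ \oo --> l ->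
  (\forall n \near \oo, u n = v n) -> v @ \oo --> l.
Proof. by move=> /[swap] uv; apply: cvg_trans; exact: near_eq_cvg. Qed.

Lemma cvgn_exprn u l k : u @ \oo --> l -> (fun n => u n ^+ k) @ \oo --> l ^+ k.
Proof. by move=> ul; exact: (cvg_comp _ _ ul (@exprn_continuous R k l)). Qed.

Lemma cvgn_sum (F : nat -> nat -> R) (l : nat -> R) K :
  (forall k, F k @ \oo --> l k) ->
  (fun n => \sum_(k < K) F k n) @ \oo --> \sum_(k < K) l k.
Proof.
move=> Fl; elim: K => [|K IH].
  by rewrite big_ord0; under eq_fun do rewrite big_ord0; exact: cvg_cst.
by rewrite big_ord_recr; under eq_fun do rewrite big_ord_recr; exact: cvgD.
Qed.

Lemma cvgn_natV : (fun n => n%:R^-1) @ \oo --> (0 : R).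
Proof. by rewrite -cvg_shiftS; exact: cvg_harmonic. Qed.

Lemma cvgn_divn u l : u @ \oo --> l -> (fun n => u n / n%:R) @ \oo --> 0.
Proof. by move=> ul; rewrite -(mulr0 l); apply: cvgM => //; exact: cvgn_natV. Qed.

(** Induction through [(k + 1) * 'C(n - 1, k + 1) = (n - k - 1) * 'C(n - 1, k)]. *)
Lemma cvgn_bin k : (fun n => 'C(n.-1, k)%:R / n%:R ^+ k) @ \oo --> (k`!%:R^-1 : R).
Proof.
elim: k => [|k IH].
  by under eq_fun do rewrite bin0 expr0 divr1; rewrite fact0 invr1; exact: cvg_cst.
have h : (fun n => 1 - k.+1%:R / n%:R) @ \oo --> (1 : R).
  rewrite -[X in _ --> X]subr0; apply: cvgB; first exact: cvg_cst.
  by apply: cvgn_divn; exact: cvg_cst.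
have -> : (k.+1)`!%:R^-1 = k`!%:R^-1 * 1 / k.+1%:R :> R.
  by rewrite factS natrM invfM mulr1 mulrC.
have h' : (fun=> k.+1%:R^-1 : R) @ \oo --> (k.+1%:R^-1 : R) by exact: cvg_cst.
apply: (cvgn_near_eq (cvgM (cvgM IH h) h')); near=> n.
have nk : (k.+1 <= n)%N by near: n; exact: nbhs_infty_ge.
have n0 : n%:R != 0 :> R by rewrite pnatr_eq0; case: (n) nk.
have e : k.+1%:R * 'C(n.-1, k.+1)%:R = (n%:R - k.+1%:R) * 'C(n.-1, k)%:R :> R.
  rewrite -natrB// -!natrM mul_bin_left; congr (_ * _)%:R; lia.
have k0 : k.+1%:R != 0 :> R by rewrite pnatr_eq0.
have {e} -> : 'C(n.-1, k.+1)%:R = (n%:R - k.+1%:R) * 'C(n.-1, k)%:R / k.+1%:R :> R.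
  by rewrite -e mulrAC mulfV// mul1r.
rewrite /= exprS; field.
by rewrite expf_neq0// n0 /= addrC natr1.
Unshelve. all: by end_near. Qed.

Lemma cvgn_expR u l : u @ \oo --> l -> (fun n => expR (u n)) @ \oo --> expR l.
Proof. by move=> ul; exact: (cvg_comp _ _ ul (@continuous_expR R l)). Qed.

Lemma cvgn_1Bdivn u C : u @ \oo --> C ->
  (fun n => (1 - u n / n%:R) ^+ n) @ \oo --> expR (- C).
Proof.
move=> uC; have t0 := cvgn_divn uC.
(* With [t = u n / n], these are the [n]-th powers of the bounds [exp (- t / (1 - t)) <= 1 - t <=
   exp (- t)]. *)
apply: (@squeeze_cvgr _ _ _ _ (fun n => expR (- (u n / (1 - u n / n%:R)))) (fun n => expR
  (- u n))).
- near=> n.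
  have n0 : n%:R != 0 :> R.
    by rewrite pnatr_eq0 -lt0n; near: n; exact: nbhs_infty_ge.
  have t1 : u n / n%:R < 1 by near: n; apply: (cvgr_lt _ t0).
  set t := u n / n%:R in t1 *.
  have -> : u n = n%:R * t by rewrite /t mulrC divfK.
  have t1' : 0 < 1 - t by rewrite subr_gt0.
  have e1 : - (n%:R * t / (1 - t)) = n%:R * (- (t / (1 - t))) by ring.
  have e2 : - (n%:R * t) = n%:R * - t by ring.
  rewrite e1 e2 !expRM_natl; apply/andP; split.
    rewrite lerXn2r ?nnegrE ?expR_ge0 ?(ltW t1')// expRN invf_ple ?posrE ?expR_gt0//.
    apply: le_trans (expR_ge1Dx _); rewrite le_eqVlt; apply/orP; left; apply/eqP.
    by field; rewrite gt_eqF.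
  by rewrite lerXn2r ?nnegrE ?expR_ge0 ?(ltW t1')//; exact: expR_ge1Dx.
- apply: cvgn_expR; apply: cvgN; rewrite -[X in _ --> X]divr1; apply: cvgM => //.
  apply: cvgV; first exact: oner_neq0.
  by rewrite -[X in _ --> X]subr0; apply: cvgB => //; exact: cvg_cst.
- by apply: cvgn_expR; exact: cvgN.
Unshelve. all: by end_near. Qed.

(** With [t = 1 - u n / n] the power is [(t ^ n / t ^ s) ^ s], where [t ^ n] tends to [exp (- C)]
    and [t ^ s] to 1. *)
Lemma cvgn_1Bdivn_boundary u C s : u @ \oo --> C ->
  (fun n => (1 - u n / n%:R) ^+ (s * (n - s))) @ \oo --> expR (- (C * s%:R)).
Proof.
move=> uC; have t0 := cvgn_divn uC.
have t1 : (fun n => 1 - u n / n%:R) @ \oo --> (1 : R).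
  by rewrite -[X in _ --> X]subr0; apply: cvgB => //; exact: cvg_cst.
rewrite -mulNr mulrC expRM_natl.
have t1s := @cvgn_exprn _ _ s t1; rewrite expr1n in t1s.
have t1v : (fun n => ((1 - u n / n%:R) ^+ s)^-1) @ \oo --> (1^-1 : R).
  by apply: cvgV => //; exact: oner_neq0.
have lim := @cvgn_exprn _ _ s (cvgM (cvgn_1Bdivn uC) t1v).
rewrite invr1 mulr1 in lim; apply: (cvgn_near_eq (lim _)); near=> n.
have ns : (s <= n)%N by near: n; exact: nbhs_infty_ge.
have h : 0 < 1 - u n / n%:R by near: n; apply: (cvgr_gt _ t1).
rewrite /= mulnC exprM; congr (_ ^+ _).
set t := 1 - _ in h *; have -> : t ^+ n = t ^+ (n - s) * t ^+ s by rewrite -exprD subnK.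
by rewrite mulfK// expf_neq0// gt_eqF.
Unshelve. all: by end_near. Qed.

(** The left side equals [(k + 1) ^ (k + 1) / (k + 1)!], one term of the exponential series at
    [k + 1]. *)
Lemma powE_le_expR k : k.+1%:R ^+ k / k`!%:R <= expR k.+1%:R :> R.
Proof.
have := @expR_ge1Dxn R k.+1%:R k (ler0n _ _); rewrite factS exprS natrM.
rewrite -mulf_div divff ?pnatr_eq0// mul1r; lra.
Qed.

Lemma bin_le_pow n k : 'C(n.-1, k)%:R <= n%:R ^+ k / k`!%:R :> R.
Proof.
rewrite ler_pdivlMr ?ltr0n ?fact_gt0// -natrM -natrX ler_nat bin_ffact.
elim: k => // k IH; rewrite ffactnSr expnSr leq_mul//.
by rewrite (leq_trans (leq_subr _ _))// leq_pred.
Qed.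

(** With [s = k + 1], the term [v * s / n] in the exponent reflects that the boundary has
    [s * (n - s)] edges rather than [s * n]. For [s <= n / 2] the decay rate is near
    [C / 2 - 1 - ln C], for [s = o(n)] near [delta C]. *)
Lemma tree_term_le n k (u v : R) : (k < n)%N -> 1 <= u -> v <= n%:R ->
  'C(n.-1, k)%:R * (k.+1%:R ^+ k * (u / n%:R) ^+ k * (1 - v / n%:R) ^+ (k.+1 * (n - k.+1)))
  <= expR (k.+1%:R * (1 + ln u - v + v * (k.+1%:R / n%:R))).
Proof.
move=> kn u1 vn; have n0 : 0 < n%:R :> R by rewrite ltr0n (leq_trans _ kn).
have u0 : 0 < u by lra.
have -> : k.+1%:R * (1 + ln u - v + v * (k.+1%:R / n%:R)) =
    k.+1%:R + k.+1%:R * ln u + (k.+1 * (n - k.+1))%:R * (- (v / n%:R)).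
  by rewrite natrM natrB//; field; rewrite gt_eqF.
rewrite !expRD !expRM_natl lnK ?posrE// mulrA; apply: ler_pM.
- by rewrite !mulr_ge0 ?exprn_ge0 ?divr_ge0 ?(ltW u0) ?(ltW n0).
- by rewrite exprn_ge0// subr_ge0 ler_pdivrMr// mul1r.
- apply: (@le_trans _ _ ((n%:R ^+ k / k`!%:R) * (k.+1%:R ^+ k * (u / n%:R) ^+ k))).
    by rewrite ler_wpM2r ?bin_le_pow// mulr_ge0 ?exprn_ge0// divr_ge0 ?(ltW u0) ?(ltW n0).
  have -> : n%:R ^+ k / k`!%:R * (k.+1%:R ^+ k * (u / n%:R) ^+ k) =
      (k.+1%:R ^+ k / k`!%:R) * u ^+ k.
    rewrite expr_div_n; field.
    by rewrite expf_neq0 ?gt_eqF// ltr0n fact_gt0.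
  apply: ler_pM.
  + by rewrite divr_ge0 ?exprn_ge0.
  + by rewrite exprn_ge0 ?(ltW u0).
  + exact: powE_le_expR.
  by rewrite exprS ler_peMl// exprn_ge0 ?(ltW u0).
- rewrite lerXn2r ?nnegrE ?expR_ge0 ?expR_ge1Dx//.
  by rewrite subr_ge0 ler_pdivrMr// mul1r.
Qed.

Lemma geometric_tail (d X : R) n : 0 < d ->
  \sum_(k < n | X < k.+1%:R) expR (- d * k.+1%:R) <= expR (- d * X) / (1 - expR (- d)).
Proof.
move=> d0; have z1 : expR (- d) < 1 by rewrite -expR0 ltr_expR; lra.
rewrite ler_pdivlMr ?subr_gt0//.
(* Telescoped form that carries the induction; the maximum with 0 covers the stage where no index
   has yet exceeded [X]. *)
apply: (@le_trans _ _ (Num.max 0 (expR (- d * X) - expR (- d * n.+1%:R)))); last first.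
  by rewrite ge_max expR_ge0 /= gerBl expR_ge0.
elim: n => [|n IH]; first by rewrite big_ord0 mul0r le_max lexx.
rewrite big_mkcond big_ord_recr -big_mkcond /= mulrDl.
case: ifPn => Xn.
  have e : expR (- d * n.+2%:R) = expR (- d * n.+1%:R) * expR (- d).
    by rewrite -expRD; congr expR; rewrite -[n.+2%:R]natr1; ring.
  rewrite le_max e; apply/orP; right.
  have : expR (- d * n.+1%:R) <= expR (- d * X).
    by rewrite ler_expR !mulNr lerN2 ler_pM2l// ltW.
  move: IH; rewrite le_max => /orP[]; nra.
rewrite mul0r addr0; apply: le_trans IH _; rewrite ge_max le_max lexx /=.
rewrite -leNgt in Xn; rewrite le_max; apply/orP; left.
by rewrite subr_le0 ler_expR !mulNr lerN2 ler_pM2l.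
Qed.

(** Square [exp y >= y] at [y = a * n / 2]. *)
Lemma natM_expRN_le (a : R) n : 0 < a -> (0 < n)%N ->
  n%:R * expR (- a * n%:R) <= 4 / (a ^+ 2 * n%:R).
Proof.
move=> a0 n0; have n0' : 0 < n%:R :> R by rewrite ltr0n.
have h : a * n%:R / 2 <= expR (a * n%:R / 2).
  by apply: le_trans (expR_ge1Dx _); rewrite lerDr.
have h2 : (a * n%:R / 2) ^+ 2 <= expR (a * n%:R).
  have -> : expR (a * n%:R) = expR (a * n%:R / 2) ^+ 2.
    by rewrite -expRM_natl; congr expR; field.
  by rewrite lerXn2r ?nnegrE ?expR_ge0// divr_ge0// mulr_ge0 ?(ltW a0) ?(ltW n0').
rewrite mulNr expRN ler_pdivrMr ?expR_gt0//.
rewrite [leRHS]mulrAC ler_pdivlMr ?mulr_gt0 ?exprn_gt0//.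
have -> : n%:R * (a ^+ 2 * n%:R) = 4 * (a * n%:R / 2) ^+ 2 by field.
by rewrite ler_wpM2l.
Qed.

Lemma ln_le_linear (a : R) : 0 < a -> \forall n \near \oo, ln n%:R <= a * n%:R.
Proof.
move=> a0; near=> n.
have n0 : (0 < n)%N by near: n; exact: nbhs_infty_ge.
have na : 4 / a ^+ 2 <= n%:R by near: n; exact: nbhs_infty_ger.
rewrite -[leRHS]expRK ler_ln ?posrE ?expR_gt0 ?ltr0n//.
have := natM_expRN_le a0 n0; rewrite mulNr expRN.
have h : 4 / (a ^+ 2 * n%:R) <= 1.
  rewrite ler_pdivrMr ?mulr_gt0 ?exprn_gt0 ?ltr0n// mul1r mulrC.
  by rewrite -ler_pdivrMr ?exprn_gt0.
by move=> /le_trans/(_ h); rewrite ler_pdivrMr ?expR_gt0// mul1r.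
Unshelve. all: by end_near. Qed.

End Limits.

(** * The giant component *)

Section GiantComponent.
Context {n : nat}.
Implicit Types (w : config n) (i j : 'I_n) (A B : pred nat).

Lemma num_in_split A B w :
  num_in A w = (num_in (fun s => A s && B s) w + num_in (fun s => A s && ~~ B s) w)%N.
Proof.
rewrite /num_in -[LHS](cardsID [set i | B #|Defs.comp w i|]); congr (_ + _)%N.
  by apply: eq_card => i; rewrite !inE.
by apply: eq_card => i; rewrite !inE andbC.
Qed.

Lemma num_in_eq0 A w i : num_in A w = 0%N -> ~~ A #|Defs.comp w i|.
Proof. by move=> /cards0_eq/setP/(_ i); rewrite !inE => ->. Qed.

Lemma mem_comp w i : i \in Defs.comp w i. Proof. by rewrite inE connect0. Qed.

Lemma is_comp_comp w i : is_comp w (Defs.comp w i).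
Proof. by rewrite /is_comp -(comp_eq w (mem_comp w i)). Qed.

Lemma mem_comp_eq w i j : (j \in Defs.comp w i) = (Defs.comp w j == Defs.comp w i).
Proof.
apply/idP/eqP => [ji|<-]; last exact: mem_comp.
by apply/eqP; rewrite comp_eq//; exact: is_comp_comp.
Qed.

(** Disjoint components cannot both have more than [n / 2] vertices, so everything outside the large
    one is small. *)
Lemma num_in_small_giant w i : (n < 2 * #|Defs.comp w i|)%N ->
  (forall j, j \notin Defs.comp w i -> (2 * #|Defs.comp w j| <= n)%N) /\
  (#|Defs.comp w i| + num_in (fun s => (2 * s <= n)%N) w = n)%N.
Proof.
move=> ni.
have small j : j \notin Defs.comp w i -> (2 * #|Defs.comp w j| <= n)%N.
  rewrite mem_comp_eq => ji.
  have dij := is_comp_disjoint (is_comp_comp w j) (is_comp_comp w i) ji.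
  have : (#|Defs.comp w j| + #|Defs.comp w i| <= n)%N.
    have := max_card (mem (Defs.comp w j :|: Defs.comp w i)).
    by rewrite cardsU disjoint_setI0// cards0 subn0 card_ord.
  by lia.
split=> //; rewrite -[RHS](card_ord n) -(cardsC (Defs.comp w i)); congr (_ + _)%N.
apply: eq_card => j; rewrite finset.in_setC [LHS]inE.
case: (boolP (j \in Defs.comp w i)) => [|/small //].
by rewrite mem_comp_eq => /eqP ->; lia.
Qed.

(** The deterministic part: the last three hypotheses exclude the three bad events, and [H3] is then
    read off from the count of vertices in components of size at most [n / 2]. *)
Lemma good_event_H3 {R : realType} (C M gamma m : R) (K : nat) w :
  (0 < n)%N -> 0 < gamma -> (2 * K <= n)%N -> M * ln n%:R <= gamma / 4 * n%:R ->
  `|m / n%:R - q C| < gamma / 4 ->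
  num_in (fun s => (M * ln n%:R < s%:R) && (2 * s <= n)%N) w = 0%N ->
  (num_in (fun s => (K < s) && (2 * s <= n))%N w)%:R < gamma / 4 * n%:R ->
  `|(num_in (fun s => s <= K)%N w)%:R - m| < gamma / 4 * n%:R ->
  H3 n C M gamma w.
Proof.
move=> n0 g0 Kn Mn mq big0 mid low.
have n0' : 0 < n%:R :> R by rewrite ltr0n.
pose small s := (2 * s <= n)%N.
have split_small : num_in small w =
    (num_in (fun s => s <= K) w + num_in (fun s => (K < s) && (2 * s <= n)) w)%N.
  rewrite (num_in_split _ (fun s => s <= K)%N) /num_in; congr (_ + _)%N.
    by apply: eq_card => i; rewrite !inE /small; lia.
  by apply: eq_card => i; rewrite !inE /small -ltnNge andbC.
have small_log i : small #|Defs.comp w i| -> #|Defs.comp w i|%:R <= M * ln n%:R.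
  by move=> si; have := num_in_eq0 i big0; rewrite -/(small _) si andbT -leNgt.
have mq' : `|m - q C * n%:R| < gamma / 4 * n%:R.
  have -> : m - q C * n%:R = (m / n%:R - q C) * n%:R by field; rewrite gt_eqF.
  by rewrite normrM normr_nat ltr_pM2r.
(* Three errors of [gamma / 4 * n] each: vertices in components of size between [K] and [n / 2], the
   deviation of the low count from [m], and that of [m] from [q C * n]. *)
have {split_small low mid mq' mq} : `|(num_in small w)%:R - q C * n%:R| < 3 * gamma / 4 *
  n%:R.
  rewrite split_small natrD; move: low mid mq'.
  set b := (num_in (fun s => (K < s) && (2 * s <= n))%N w)%:R.
  have : 0 <= b by [].
  by rewrite !ltr_norml => b0 /andP[? ?] ? /andP[? ?]; apply/andP; split; lra.
rewrite ltr_norml => /andP[Nq qN].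
have gn : 0 < gamma * n%:R by exact: mulr_gt0.
apply/existsP; case: (boolP [exists i, n < 2 * #|Defs.comp w i|]%N).
  move=> /existsP[i ni]; exists i; have [small_j iN] := num_in_small_giant ni.
  have iN' : #|Defs.comp w i|%:R = n%:R - (num_in small w)%:R :> R.
    by rewrite -[in n%:R]iN natrD addrK.
  apply/andP; split.
    by rewrite iN' !mulrDl !mulNr mul1r; apply/andP; split; lra.
  by apply/forallP => j; apply/implyP; rewrite -mem_comp_eq => /small_j /small_log.
rewrite negb_exists => /forallP all_small.
have {}all_small i : small #|Defs.comp w i| by rewrite /small leqNgt.
have Nn : num_in small w = n.
  rewrite -[RHS](card_ord n); apply: eq_card => i.
  by rewrite [LHS]inE; exact: all_small.
(* Without a giant, [1 - q C] is within [3 / 4 * gamma] of 0, so the lower bound is negative and the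
   upper one exceeds [gamma / 4 * n >= M * ln n]; any vertex is a witness. *)
exists (Ordinal n0); rewrite {}Nn in Nq qN; apply/andP; split.
  have h := small_log _ (all_small (Ordinal n0)).
  have h0 : 0 <= #|Defs.comp w (Ordinal n0)|%:R :> R by [].
  by rewrite !mulrDl !mulNr mul1r; apply/andP; split; lra.
by apply/forallP => j; apply/implyP => _; exact: small_log.
Qed.

End GiantComponent.

(** * Asymptotics of the expected counts *)

Lemma divn_le_half {R : realType} (s n : nat) : (2 * s <= n)%N -> s%:R / n%:R <= 2^-1 :> R.
Proof.
case: n => [|n] sn; first by rewrite invr0 mulr0.
rewrite ler_pdivrMr ?ltr0n//; have : (2 * s)%:R <= n.+1%:R :> R by rewrite ler_nat.
by rewrite natrM; lra.
Qed.

Section Asymptotics.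
Context {R : realType}.
Variables (C : R) (an : nat -> R) (p : forall n, edge n -> R).
Hypotheses (C1 : 1 < C) (an0 : forall n, 0 <= an n) (ancvg : an @ \oo --> (0 : R))
  (p01 : forall n (e : edge n), 0 <= p e <= 1)
  (pb : forall n (e : edge n), (C - an n) / n%:R <= p e <= (C + an n) / n%:R).

Let u n := C + an n.
Let v n := C - an n.

Definition mean (A : pred nat) n := bern_exp (@p n) (fun w => (num_in A w)%:R).

Let cvg_u : (u @ \oo --> C).
Proof. by rewrite -[X in (_ --> X)]addr0; apply: cvgD => //; exact: cvg_cst. Qed.

Let cvg_v : (v @ \oo --> C).
Proof. by rewrite -[X in (_ --> X)]subr0; apply: cvgB => //; exact: cvg_cst. Qed.

(** Conditions valid for all large [n]: [1 <= u n] gives [u n ^ k <= u n ^ (k + 1)], and [u n < n]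
    keeps the edge probabilities below 1. *)
Let regime n := [/\ (0 < n)%N, 0 <= v n, v n <= u n, 1 <= u n & u n < n%:R].

Let near_regime : \forall n \near \oo, regime n.
Proof.
near=> n.
have a0 := an0 n; rewrite /regime; split; rewrite /v /u; last 2 first.
- by move: C1; lra.
- apply: (@lt_trans _ _ (C + 1)); last by near: n; exact: nbhs_infty_gtr.
  by rewrite -/(u n); near: n; apply: (cvgr_lt _ cvg_u); rewrite ltrDl.
- by near: n; exact: nbhs_infty_ge.
- by rewrite -/(v n); near: n; apply: (cvgr_ge _ cvg_v); exact: lt_trans ltr01 C1.
- by lra.
Unshelve. all: by end_near. Qed.

Let x_lt1 n : regime n -> u n / n%:R < 1.
Proof. by case=> n0 _ _ _ un; rewrite ltr_pdivrMr ?ltr0n// mul1r. Qed.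

Let px n (e : edge n) : p e <= u n / n%:R. Proof. by case/andP: (pb e). Qed.
Let yp n (e : edge n) : v n / n%:R <= p e. Proof. by case/andP: (pb e). Qed.

Let yx n : regime n -> v n / n%:R <= u n / n%:R.
Proof. by case=> n0 _ vu _ _; rewrite ler_pM2r ?invr_gt0 ?ltr0n. Qed.

Let y0 n : regime n -> 0 <= v n / n%:R.
Proof. by case=> n0 v0 _ _ _; rewrite divr_ge0. Qed.

Lemma mean_ge0 A n : 0 <= mean A n.
Proof. by apply: bern_exp_ge0 => //; exact: p01. Qed.

Lemma mean_le A n : mean A n <= n%:R.
Proof.
rewrite -(bern_exp_cst (@p n) n%:R); apply: ler_bern_exp => [|w]; first exact: p01.
by rewrite ler_nat num_in_le.
Qed.

Definition qterm (k : nat) : R :=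
  (Tcount k.+1)%:R * C ^+ k * expR (- (C * k.+1%:R)) / (k`!)%:R.

(** Squeeze between the two sharp bounds: the graphs that are not trees carry a factor [u n / n],
    and closing the fixed number [E] of inner edges costs a factor tending to 1. *)
Lemma mean_size_cvg k :
  ((fun n => mean (pred1 k.+1) n / n%:R) @ \oo --> qterm k).
Proof.
pose T := (Tcount k.+1)%:R : R.
pose N := #|{set edge k.+1}|%:R : R.
pose E := #|{: edge k.+1}|.
have qE : qterm k = (k`!%:R)^-1 * (T * C ^+ k) * expR (- (C * k.+1%:R)).
  by rewrite /qterm -/T; ring.
have cu := @cvgn_exprn _ _ _ k cvg_u; have cv := @cvgn_exprn _ _ _ k cvg_v.
have du := cvgn_divn cvg_u; have cb := @cvgn_bin R k.
have lower : (fun n => 'C(n.-1, k)%:R / n%:R ^+ k * (T * v n ^+ k * (1 - u n / n%:R) ^+ E) *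
    (1 - u n / n%:R) ^+ (k.+1 * (n - k.+1))) @ \oo --> qterm k.
  rewrite qE; apply: cvgM; last exact: cvgn_1Bdivn_boundary.
  apply: cvgM => //; rewrite -[X in _ --> X]mulr1; apply: cvgM.
    by apply: cvgM => //; exact: cvg_cst.
  rewrite -[X in _ --> X](expr1n R E);
    apply: (@cvgn_exprn R (fun n => 1 - u n / n%:R) 1 E); rewrite -[X in _ --> X]subr0.
  by apply: cvgB => //; exact: cvg_cst.
have upper : (fun n => 'C(n.-1, k)%:R / n%:R ^+ k *
    (T * u n ^+ k + N * u n ^+ k * (u n / n%:R)) *
    (1 - v n / n%:R) ^+ (k.+1 * (n - k.+1))) @ \oo --> qterm k.
  rewrite qE; apply: cvgM; last exact: cvgn_1Bdivn_boundary.
  apply: cvgM => //; rewrite -[X in _ --> X]addr0 -(mulr0 (N * C ^+ k)); apply: cvgD.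
    by apply: cvgM => //; exact: cvg_cst.
  by apply: cvgM => //; apply: cvgM => //; exact: cvg_cst.
apply: (squeeze_cvgr _ lower upper); near=> n.
have reg : regime n by near: n; exact: near_regime.
have n0 : 0 < n%:R :> R by case: reg; rewrite ltr0n.
have lo := exp_size_lower (@p01 n) (@px n) (x_lt1 reg) (@yp n) (y0 reg) (yx reg) k.
have up := exp_size_upper (@p01 n) (@px n) (x_lt1 reg) (@yp n) (y0 reg) (yx reg) k.
rewrite ler_pdivlMr// ler_pdivrMr//; apply/andP; split.
  apply: le_trans lo; rewrite le_eqVlt; apply/orP; left; apply/eqP.
  rewrite -/T -/E expr_div_n; field.
  by rewrite expf_neq0// gt_eqF.
apply: le_trans up _; rewrite le_eqVlt; apply/orP; left; apply/eqP.
rewrite -/T -/N !exprS expr_div_n; field.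
by rewrite gt_eqF// expf_neq0// gt_eqF.
Unshelve. all: by end_near. Qed.

Lemma mean_low_cvg K :
  (fun n => mean (fun s => s <= K)%N n / n%:R) @ \oo --> \sum_(k < K) qterm k.
Proof.
have := @cvgn_sum R (fun k n => mean (pred1 k.+1) n / n%:R) qterm K mean_size_cvg.
move=> lim; apply: (cvgn_near_eq lim); near=> n.
have Kn : (K <= n)%N by near: n; exact: nbhs_infty_ge.
rewrite {2}/mean exp_num_in_sizes -mulr_suml; congr (_ * _).
exact: (big_ord_widen n (fun k => mean (pred1 k.+1) n)).
Unshelve. all: by end_near. Qed.

Lemma qterm_ge0 k : 0 <= qterm k.
Proof. by rewrite /qterm divr_ge0// mulr_ge0 ?expR_ge0// mulr_ge0// exprn_ge0// ltW//
  (lt_trans ltr01 C1). Qed.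

(** The partial sums are limits of expected proportions of vertices, hence at most 1; so the [limn]
    defining [q] is a genuine limit. *)
Lemma cvg_qseries : (fun K => \sum_(k < K) qterm k) @ \oo --> q C.
Proof.
have -> : (fun K => \sum_(k < K) qterm k) = series qterm.
  by apply/funext => K; rewrite seriesEnat /= big_mkord.
apply: nondecreasing_is_cvgn.
  by apply: nondecreasing_series => k _ _; exact: qterm_ge0.
exists 1 => _ [K _ <-]; rewrite seriesEnat /= big_mkord.
have lim := @mean_low_cvg K.
rewrite -(cvg_lim _ lim)//; apply: limr_le; first by apply/cvg_ex; eexists; exact: lim.
near=> n; have n0 : (0 < n)%N by near: n; exact: nbhs_infty_ge.
by rewrite ler_pdivrMr ?ltr0n// mul1r mean_le.
Unshelve. all: by end_near. Qed.

Lemma mean_tail_le (A : pred nat) n : regime n -> mean A n <=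
  n%:R * \sum_(k < n | A k.+1)
    expR (k.+1%:R * (1 + ln (u n) - v n + v n * (k.+1%:R / n%:R))).
Proof.
move=> reg; have [_ _ vu u1 un] := reg.
rewrite /mean exp_num_in_sizes mulr_sumr; apply: ler_sum => k _.
apply: le_trans (exp_size_tail (@p01 n) (@px n) (@yp n) (y0 reg) (yx reg) k) _.
by rewrite -mulrA ler_wpM2l//; apply: tree_term_le => //; exact: le_trans vu (ltW un).
Qed.

(** * Exponential decay and concentration above the threshold *)

Hypothesis C_half : 0 < C / 2 - 1 - ln C.

(** Half of the available rate; the other half absorbs the differences between [u n], [v n] and
    [C]. *)
Let c := (C / 2 - 1 - ln C) / 2.

Let c_gt0 : 0 < c. Proof. by rewrite divr_gt0. Qed.

(** [eps] stands for a bound on [s / n], used both with [1 / 2] and with a small constant. *)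
Let near_exponent (eps d : R) : d < C - 1 - ln C - C * eps ->
  \forall n \near \oo, 1 + ln (u n) - v n + v n * eps < - d.
Proof.
move=> hd.
have lim : (fun n => 1 + ln (u n) - v n + v n * eps) @ \oo --> 1 + ln C - C + C * eps.
  apply: cvgD; last by apply: cvgM => //; exact: cvg_cst.
  apply: cvgB => //; apply: cvgD; first exact: cvg_cst.
  by apply: (cvg_comp _ _ cvg_u); apply: continuous_ln; exact: lt_trans ltr01 C1.
by apply: (cvgr_lt _ lim); lra.
Qed.

Lemma near_mean_mid : \forall n \near \oo, forall K,
  mean (fun s => (K < s) && (2 * s <= n))%N n <=
  n%:R * (expR (- c * K%:R) / (1 - expR (- c))).
Proof.
near=> n => K.
have reg : regime n by near: n; exact: near_regime.
have [n0 v0 _ _ _] := reg; have n0' : 0 < n%:R :> R by rewrite ltr0n.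
have hc : 1 + ln (u n) - v n + v n * 2^-1 < - c.
  by near: n; apply: near_exponent; rewrite /c; move: C_half; lra.
apply: le_trans (mean_tail_le _ reg) _; rewrite ler_wpM2l//.
apply: le_trans (geometric_tail K%:R n c_gt0).
rewrite big_mkcond [leRHS]big_mkcond; apply: ler_sum => k _; rewrite ltr_nat.
case: (K < k.+1)%N => //=; case: ifPn => kn; last exact: expR_ge0.
rewrite ler_expR mulrC ler_pM2r ?ltr0n//; apply: le_trans (ltW hc).
by rewrite lerD2l ler_wpM2l// divn_le_half.
Unshelve. all: by end_near. Qed.

(** Sizes up to [eps * n] decay at a rate [d < delta C] with [d * M > 1], so that
    [n * n ^ (- d * M)] tends to 0; sizes from [eps * n] to [n / 2] decay at rate [c], for a total
    of order [n * exp (- c * eps * n)]. *)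
Lemma near_mean_big (M eta : R) : 1 / delta C < M -> 0 < eta ->
  \forall n \near \oo,
    mean (fun s => (M * ln n%:R < s%:R) && (2 * s <= n)%N) n <= eta.
Proof.
move=> hM eta0.
have d0 : 0 < delta C by rewrite /delta; move: C_half C1; lra.
have M0 : 0 < M by apply: lt_trans hM; rewrite divr_gt0.
have hMd : 1 / M < delta C by rewrite ltr_pdivrMr// mulrC -ltr_pdivrMr.
have [d /andP[Md dd]] : exists d, 1 / M < d < delta C.
  by exists ((1 / M + delta C) / 2); rewrite !midf_lt.
have dpos : 0 < d by apply: lt_trans Md; rewrite divr_gt0.
have b0 : 0 < d * M - 1 by rewrite subr_gt0 -ltr_pdivrMr.
have C0 : 0 < C := lt_trans ltr01 C1.
(* This [eps] spends half of the gap [delta C - d] on the boundary correction [C * eps]. *)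
have [eps eps0 Ceps] : exists2 eps, 0 < eps & C * eps = (delta C - d) / 2.
  exists ((delta C - d) / (2 * C)); last by field; rewrite gt_eqF.
  by rewrite divr_gt0 ?subr_gt0 ?mulr_gt0.
pose z1 := 1 - expR (- d); pose z2 := 1 - expR (- c).
have z1_gt0 : 0 < z1 by rewrite subr_gt0 -expR0 ltr_expR; lra.
have z2_gt0 : 0 < z2 by rewrite subr_gt0 -expR0 ltr_expR; move: c_gt0; lra.
near=> n.
have reg : regime n by near: n; exact: near_regime.
have [n0 v0 _ _ _] := reg; have n0' : 0 < n%:R :> R by rewrite ltr0n.
have hc : 1 + ln (u n) - v n + v n * 2^-1 < - c.
  by near: n; apply: near_exponent; rewrite /c; move: C_half; lra.
have hd : 1 + ln (u n) - v n + v n * eps < - d.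
  by near: n; apply: near_exponent; rewrite Ceps -/(delta C); lra.
(* Thresholds obtained by solving [e1] and [e2] below for [n], the second after applying
   [natM_expRN_le]. *)
have n1 : expR (- ln (eta / 2 * z1) / (d * M - 1)) <= n%:R by near: n;
  exact: nbhs_infty_ger.
have n2 : 4 / ((c * eps) ^+ 2 * (eta / 2 * z2)) <= n%:R by near: n; exact: nbhs_infty_ger.
apply: le_trans (mean_tail_le _ reg) _.
apply: (@le_trans _ _ (n%:R * (expR (- d * (M * ln n%:R)) / z1 + expR (- c * (eps *
  n%:R)) / z2))).
  rewrite ler_wpM2l//.
  apply: (le_trans _ (lerD (geometric_tail (M * ln n%:R) n dpos) (geometric_tail (eps *
    n%:R) n c_gt0))).
  rewrite big_mkcond [X in _ <= X + _]big_mkcond [X in _ <= _ + X]big_mkcond -big_split /=.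
  apply: ler_sum => k _; case: (M * ln n%:R < k.+1%:R) => /=; last first.
    by rewrite add0r; case: ifP => // _; exact: expR_ge0.
  case: ifPn => kn; last by apply: addr_ge0; [|case: ifP => // _]; exact: expR_ge0.
  have [kn'|kn'] := ltP (eps * n%:R) k.+1%:R.
    rewrite -[leLHS]add0r; apply: lerD; first exact: expR_ge0.
    rewrite ler_expR mulrC ler_pM2r ?ltr0n//; apply: le_trans (ltW hc).
    by rewrite lerD2l ler_wpM2l// divn_le_half.
  rewrite addr0 ler_expR mulrC ler_pM2r ?ltr0n//; apply: le_trans (ltW hd).
  by rewrite lerD2l ler_wpM2l// ler_pdivrMr.
have e1 : n%:R * (expR (- d * (M * ln n%:R)) / z1) <= eta / 2.
  rewrite mulrA ler_pdivrMr// -{1}[n%:R]lnK ?posrE// -expRD.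
  have e0 : 0 < eta / 2 * z1 by rewrite mulr_gt0// divr_gt0.
  rewrite -[leRHS]lnK ?posrE// ler_expR.
  have -> : ln n%:R + - d * (M * ln n%:R) = - (ln n%:R * (d * M - 1)) by ring.
  rewrite lerNl -ler_pdivrMr//.
  by rewrite -[leLHS]expRK ler_ln ?posrE ?expR_gt0.
have e2 : n%:R * (expR (- c * (eps * n%:R)) / z2) <= eta / 2.
  rewrite mulrA ler_pdivrMr// mulrA mulNr.
  have ce0 : 0 < c * eps by rewrite mulr_gt0.
  apply: le_trans (natM_expRN_le ce0 n0) _.
  have e0 : 0 < eta / 2 * z2 by rewrite mulr_gt0// divr_gt0.
  rewrite ler_pdivrMr ?mulr_gt0 ?exprn_gt0//.
  have ae : 0 < (c * eps) ^+ 2 * (eta / 2 * z2).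
    by apply: mulr_gt0 => //; exact: exprn_gt0.
  move: n2; rewrite ler_pdivrMr// => n2.
  by apply: le_trans n2 _; rewrite le_eqVlt; apply/orP; left; apply/eqP; ring.
rewrite mulrDr; lra.
Unshelve. all: by end_near. Qed.

(** The second moment bound leaves a variance of at most [K * n + (z - 1) * m ^ 2], where [m <= n]
    and [z], the inverse power of [1 - u n / n], tends to 1. *)
Lemma near_variance K (eta : R) : 0 < eta -> \forall n \near \oo,
  bern_exp (@p n) (fun w => (num_in (fun s => s <= K)%N w)%:R ^+ 2) -
    mean (fun s => s <= K)%N n ^+ 2 <= eta * n%:R ^+ 2.
Proof.
move=> eta0.
have lim : (fun n => K%:R / n%:R + (((1 - u n / n%:R) ^+ (K ^ 2))^-1 - 1)) @ \oo --> (0 :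
  R).
  have t1 : (fun n => 1 - u n / n%:R) @ \oo --> (1 : R).
    rewrite -[X in _ --> X]subr0; apply: cvgB; first exact: cvg_cst.
    exact: cvgn_divn cvg_u.
  have t2 := @cvgn_exprn _ _ _ (K ^ 2) t1; rewrite expr1n in t2.
  have t3 : (fun n => ((1 - u n / n%:R) ^+ (K ^ 2))^-1) @ \oo --> (1 : R).
    by rewrite -[X in _ --> X]invr1; apply: cvgV => //; exact: oner_neq0.
  rewrite -[X in _ --> X]addr0; apply: cvgD.
    by apply: cvgn_divn; exact: cvg_cst.
  by rewrite -[X in _ --> X](subrr 1); apply: cvgB => //; exact: cvg_cst.
near=> n.
have reg : regime n by near: n; exact: near_regime.
have n0 : 0 < n%:R :> R by case: reg; rewrite ltr0n.
have x0 : 0 <= u n / n%:R := le_trans (y0 reg) (yx reg).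
have sm := second_moment (@p01 n) (@px n) (x_lt1 reg) x0 (fun s (sK : (s <= K)%N) => sK).
have : K%:R / n%:R + (((1 - u n / n%:R) ^+ (K ^ 2))^-1 - 1) <= eta.
  by near: n; apply: (cvgr_le _ lim).
have m0 := mean_ge0 (fun s => s <= K)%N n; have mn := mean_le (fun s => s <= K)%N n.
move: sm; rewrite -/(mean _ n); move: (mean _ n) m0 mn => m m0 mn.
have z1 : 1 <= ((1 - u n / n%:R) ^+ (K ^ 2))^-1.
  have h := x_lt1 reg.
  rewrite invf_ge1 ?exprn_gt0 ?subr_gt0// exprn_ile1 ?gerBl//.
  by rewrite subr_ge0 ltW.
move: (bern_exp _ _) (_^-1) z1 => V z z1 sm hz.
have m2 : m ^+ 2 <= n%:R ^+ 2 by rewrite lerXn2r ?nnegrE.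
apply: (@le_trans _ _ (K%:R * n%:R + (z - 1) * n%:R ^+ 2)).
  apply: (@le_trans _ _ (K%:R * n%:R + (z - 1) * m ^+ 2)); first by move: sm; lra.
  by rewrite lerD2l ler_wpM2l// subr_ge0.
have -> : K%:R * n%:R + (z - 1) * n%:R ^+ 2 = (K%:R / n%:R + (z - 1)) * n%:R ^+ 2.
  by field; rewrite gt_eqF.
by rewrite ler_wpM2r ?sqr_ge0.
Unshelve. all: by end_near. Qed.

(** [K] is fixed first, to make the tail of [q C] and the expected mass above [K] small; then [n]
    grows. Each of the three bad events gets probability at most [gamma / 4]. *)
Lemma near_prob_H3 (M gamma : R) : 1 / delta C < M -> 0 < gamma ->
  \forall n \near \oo, 1 - gamma <= Prob (@p n) (H3 n C M gamma).
Proof.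
move=> hM g0.
have d0 : 0 < delta C by rewrite /delta; move: C_half C1; lra.
have M0 : 0 < M by apply: lt_trans hM; rewrite divr_gt0.
have g4 : 0 < gamma / 4 by rewrite divr_gt0.
have g8 : 0 < gamma / 8 by rewrite divr_gt0.
have z0 : 0 < 1 - expR (- c) by rewrite subr_gt0 -expR0 ltr_expR oppr_lt0.
(* Makes the mean of [mid] at most [(gamma / 4) ^ 2 * n], which leaves [gamma / 4] after Markov at
   level [gamma / 4 * n]. *)
pose theta := gamma / 4 * (gamma / 4) * (1 - expR (- c)).
have theta0 : 0 < theta by apply: mulr_gt0 => //; exact: mulr_gt0.
near \oo => K.
have Kq : `|q C - \sum_(k < K) qterm k| < gamma / 8.
  by near: K; move/cvgrPdist_lt: cvg_qseries; exact.
have Kc : expR (- c * K%:R) / (1 - expR (- c)) <= gamma / 4 * (gamma / 4).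
  rewrite ler_pdivrMr// -/theta -[leRHS]lnK ?posrE// ler_expR mulNr lerNl mulrC.
  by rewrite -ler_pdivrMr//; near: K; exact: nbhs_infty_ger.
have hK := @mean_low_cvg K.
near=> n.
have reg : regime n by near: n; exact: near_regime.
have n0 : (0 < n)%N by case: reg.
have n0' : 0 < n%:R :> R by rewrite ltr0n.
have mK : `|\sum_(k < K) qterm k - mean (fun s => s <= K)%N n / n%:R| < gamma / 8.
  by near: n; move/cvgrPdist_lt: hK; exact.
(* The cube leaves [gamma / 4] after Chebyshev at deviation [gamma / 4 * n]. *)
have var : bern_exp (@p n) (fun w => (num_in (fun s => s <= K)%N w)%:R ^+ 2) -
    mean (fun s => s <= K)%N n ^+ 2 <= (gamma / 4) ^+ 3 * n%:R ^+ 2.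
  by near: n; apply: near_variance; rewrite exprn_gt0.
set m := mean (fun s => s <= K)%N n in mK var *.
have mq : `|m / n%:R - q C| < gamma / 4.
  move: mK Kq; rewrite !ltr_norml => /andP[? ?] /andP[? ?]; apply/andP; split; lra.
have Kn : (2 * K <= n)%N by near: n; exact: nbhs_infty_ge.
have Mn : M * ln n%:R <= gamma / 4 * n%:R.
  have -> : gamma / 4 * n%:R = M * (gamma / 4 / M * n%:R) by field; rewrite gt_eqF.
  by rewrite ler_pM2l//; near: n; apply: ln_le_linear; rewrite divr_gt0.
pose big := num_in (fun s => (M * ln n%:R < s%:R) && (2 * s <= n)%N) : config n -> nat.
pose mid := num_in (fun s => (K < s) && (2 * s <= n))%N : config n -> nat.
pose low := num_in (fun s => s <= K)%N : config n -> nat.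
(* [big] is integer valued, so staying below 1 means vanishing. *)
pose b1 := bern_exp (@p n) (fun w => (1 <= (big w)%:R :> R)%R%:R).
pose b2 := bern_exp (@p n) (fun w => (gamma / 4 * n%:R <= (mid w)%:R)%R%:R).
pose b3 := bern_exp (@p n) (fun w => (gamma / 4 * n%:R <= `|(low w)%:R - m|)%R%:R).
have t0 : 0 < gamma / 4 * n%:R by rewrite mulr_gt0.
have hb1 : b1 <= gamma / 4.
  apply: (@le_trans _ _ (mean (fun s => (M * ln n%:R < s%:R) && (2 * s <= n)%N) n));
    last first.
    by near: n; exact: near_mean_big.
  rewrite -[leLHS]mulr1; apply: bern_markov => //; exact: p01.
have hb2 : b2 <= gamma / 4.
  rewrite -(ler_pM2r t0).
  apply: (@le_trans _ _ (mean (fun s => (K < s) && (2 * s <= n))%N n)).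
    by apply: bern_markov; [exact: p01|by []|exact: ltW].
  have hmid : forall K, mean (fun s => (K < s) && (2 * s <= n))%N n <=
      n%:R * (expR (- c * K%:R) / (1 - expR (- c))).
    by near: n; exact: near_mean_mid.
  by apply: le_trans (hmid K) _; rewrite mulrC mulrA ler_wpM2r.
have hb3 : b3 <= gamma / 4.
  have t2 : 0 < (gamma / 4 * n%:R) ^+ 2 by rewrite exprn_gt0.
  rewrite -(ler_pM2r t2).
  apply: le_trans (bern_chebyshev (fun w => (low w)%:R) (@p01 n) (ltW t0)) _.
  have -> : gamma / 4 * (gamma / 4 * n%:R) ^+ 2 = (gamma / 4) ^+ 3 * n%:R ^+ 2 by ring.
  exact: var.
have -> : Prob (@p n) (H3 n C M gamma) =
    bern_exp (@p n) (fun w => (H3 n C M gamma w)%:R) by rewrite bern_exp_pred.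
rewrite lerBlDr.
apply: (@le_trans _ _ (bern_exp (@p n) (fun w => (H3 n C M gamma w)%:R) + (b1 + (b2 +
  b3)))); last first.
  by rewrite lerD2l; move: hb1 hb2 hb3 g0; lra.
(* Union bound, checked pointwise: either [H3] holds or one of the three indicators is 1. *)
rewrite -3!bern_expD -[leLHS](bern_exp_cst (@p n)).
apply: ler_bern_exp => [|w]; first exact: p01.
have [h1|h1] := leP (1 : R) (big w)%:R; first by rewrite addrCA lerDl !addr_ge0.
have [h2|h2] := leP (gamma / 4 * n%:R) (mid w)%:R;
  first by rewrite add0r addrCA lerDl !addr_ge0.
have [h3|h3] := leP (gamma / 4 * n%:R) `|(low w)%:R - m|; first by rewrite !add0r lerDr.
rewrite (@good_event_H3 n R C M gamma m K w)// ?lerDl//.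
by apply/eqP; move: h1; rewrite ltrn1 ltnS leqn0.
Unshelve. all: by end_near. Qed.

End Asymptotics.

Theorem theorem5 (R : realType) :
  (exists! C0 : R, 1 < C0 /\ C0 / 2 - 1 - ln C0 = 0) /\
  forall C0 : R, 1 < C0 -> C0 / 2 - 1 - ln C0 = 0 ->
    C0 < 8 /\
    forall C : R, C0 < C ->
      0 < delta C /\
      forall (M alpha gamma : R) (an : nat -> R)
             (p : forall n : nat, edge n -> R),
        1 / delta C < M ->
        0 < alpha -> delta C - C * (alpha + 1 / 2) > 0 ->
        0 < gamma < 1 ->
        (forall n, 0 <= an n) -> an @ \oo --> 0 ->
        (forall n (e : edge n), 0 <= p n e <= 1) ->
        (forall n (e : edge n),
            (C - an n) / n%:R <= p n e <= (C + an n) / n%:R) ->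
        exists L4 : R, 0 < L4 /\
          forall n : nat, L4 <= n%:R ->
            1 - expR (- (alpha * C)) - gamma <= Prob (p n) (H3 n C M gamma).
Proof.
split=> [|C0 C0_gt1 C0_root]; first exact: root_unique.
split=> [|C C0C]; first exact: root_lt8.
have C1 : 1 < C by exact: lt_trans C0C.
have C_half : 0 < C / 2 - 1 - ln C.
  by rewrite -C0_root; apply: half_sub_ln_lt => //; exact: root_gt2.
split=> [|M alpha gamma an p hM _ _ /andP[g0 _] an0 anl p01 pb].
  by rewrite /delta; lra.
have [N _ hN] := near_prob_H3 C1 an0 anl p01 pb C_half hM g0.
(* The successor keeps [L4] positive even when [N] is 0. *)
exists N.+1%:R; split=> [|n]; first by rewrite ltr0n.
rewrite ler_nat => /ltnW/hN /=; apply: le_trans.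
by rewrite lerD2r gerBl expR_ge0.
Qed.
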